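(* Let $G$ be an $n$-vertex graph with $\delta(G)=\omega(\log^3 n)$ and $\Delta(G)=O(\delta(G))$. Let $F\sim G_{n,2}$ be a random $2$-regular graph on the same vertex set as $G$. Then with high probability $G\cup F$ is Hamiltonian.
   Context: Graphs are finite and simple; $\delta(G)$ and $\Delta(G)$ are the minimum and maximum degree. $G_{n,2}$ denotes the uniform distribution on all simple $2$-regular graphs on the given labelled $n$-element vertex set. $G\cup F$ is the graph on the common vertex set with edge set $E(G)\cup E(F)$. A graph is Hamiltonian if it contains a cycle through all of its vertices. Asymptotic notation refers to $n\to\infty$, so the statement concerns a sequence of graphs $G=G_n$ with $n\to\infty$: $\delta(G)=\omega(\log^3 n)$ means $\delta(G)/\log^3 n\to\infty$, and $\Delta(G)=O(\delta(G))$ means that there is a constant $K$ (independent of $n$) with $\Delta(G)\le K\delta(G)$. ''With high probability'' means with probability tending to $1$ as $n\to\infty$; the only randomness is in $F$. *)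

(* Defs.v *)
From HB Require Import structures.
From mathcomp Require Import all_boot all_order all_algebra.
From mathcomp Require Import all_classical all_reals all_analysis.
Set Implicit Arguments.
Unset Strict Implicit.
Unset Printing Implicit Defensive.
Import Order.TTheory GRing.Theory Num.Theory.
Import numFieldNormedType.Exports.
Local Open Scope ring_scope.

(* Simple graphs on a finite labelled vertex set, given by their edge sets;
   [sgraph T] is a [finType], so that one can count labelled graphs. *)
Record sgraph (T : finType) := SGraph {
  edges : {set {set T}};
  edges_card2 : [forall e in edges, #|e| == 2%N] }.

HB.instance Definition _ (T : finType) := [isSub for @edges T].
HB.instance Definition _ (T : finType) := [Finite of sgraph T by <:].

(* Irreflexive, since [set x; x] has only one element. *)
Definition adj (T : finType) (G : sgraph T) : rel T :=
  fun x y => ([set x; y] \in edges G)%SET.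

Definition deg (T : finType) (G : sgraph T) (x : T) : nat :=
  #|[pred y | adj G x y]|.

(* The default value #|T| bounds every degree, so this is the true minimum
   as soon as T is nonempty. *)
Definition min_deg (T : finType) (G : sgraph T) : nat :=
  \big[minn/#|T|]_(x : T) deg G x.

Definition max_deg (T : finType) (G : sgraph T) : nat :=
  (\max_(x : T) deg G x)%N.

Definition regular (T : finType) (d : nat) (G : sgraph T) : bool :=
  [forall x, deg G x == d].

Lemma gunion_card2 (T : finType) (G F : sgraph T) :
  [forall e in (edges G :|: edges F)%SET, #|e| == 2%N].
Proof.
apply/forall_inP => e; rewrite inE => /orP[] He.
- exact: (forall_inP (edges_card2 G)).
- exact: (forall_inP (edges_card2 F)).
Qed.

Definition gunion (T : finType) (G F : sgraph T) : sgraph T :=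
  SGraph (gunion_card2 G F).

(* [ucycle] accepts sequences of length at most 2 (a single edge traversed back
   and forth, for instance), which are not cycles of a simple graph. *)
Definition hamiltonian (T : finType) (G : sgraph T) : Prop :=
  exists c : seq T,
    [/\ (2 < size c)%N, ucycle (adj G) c & forall x : T, x \in c].

(* Probability of the event E under the uniform distribution on the elements
   of T satisfying the predicate A (0 by convention if there are none). *)
Definition uniform_pr (R : realType) (T : finType) (A : pred T) (E : T -> Prop)
    : R :=
  #|[pred t | A t && `[< E t >]]|%:R / #|A|%:R.

(* G_{n,d}: probability of an event for a uniformly random labelled simple
   d-regular graph on n vertices. *)
Definition random_regular_pr (R : realType) (n d : nat)
    (E : sgraph 'I_n -> Prop) : R :=
  uniform_pr R (@regular 'I_n d) E.
Arguments random_regular_pr : clear implicits.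

(* Main.v *)
Require Import Defs.
From mathcomp Require Import all_boot all_order all_algebra all_fingroup.
From mathcomp Require Import all_classical all_reals all_analysis.
From mathcomp Require Import fintype finset zify ring lra.

(** Let [d] be the minimum degree of [G] and [n] the number of vertices.

    A 2-regular graph [F] with [c] cycles has [2 ^ c] orientations, each of them
    a permutation, while there are at least [n! / n ^ 2] 2-regular graphs
    ([card_regular2_ge]). Hence only a proportion [n ^ 2 / 2 ^ k] of them has [k]
    cycles or more ([many_cycles]), and one may assume that [F] has [O(log n)]
    cycles, the longest of which has length at least [n / O(log n)]. Applying a
    uniformly random permutation [t] to the labels does not change the law of [F]
    ([relabel_average]), so it is enough to fix the shape of [F] and to study a
    random labelling of its vertices, that is, a random placement of [G].

    Cut the longest cycle into arcs, one for each other cycle [C]. Inside its arc,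
    [C] is absorbed without changing the ends of the arc: remove the middle edge
    of the arc, open [C] into a path, and link each inner end of the arc with an
    end of [C]. The link is found by Posa rotations along edges of [G]: if [r] is
    an end of the current path, [a] a neighbour of [r] in [G] on the path and [b]
    the vertex after [a], then [b] becomes an end. When the pivots [a] move
    steadily away from the original end, every rotation has its pivot in a part
    of the path that is still made of edges of [F], and each pair [(a, b)] can be
    examined just once ([reroute]).

    Revealing the labels of the pairs one after another, a new pair has its first
    label adjacent to the set [R] of known ends with probability about
    [#|nbrs R| / n], and its second label is a random vertex, which adds about [d]
    new neighbours while [nbrs R] is small and hits the target with probability
    about [d / n]. The potential [1 / #|nbrs R|] therefore decreases on average
    by a factor [1 - c * d / n] at each step, in every situation ([outer_sum]).
    As it is at least [1 / n] as long as the link is not found,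
    [O(n * log n / d)] pairs suffice with probability [1 - O(n ^ -2)]
    ([linked_fails]). The [O(log n)] arcs together have length
    [O(n * log n ^ 2 / d)], and they fit into a cycle of length [n / O(log n)]
    because [d] is much larger than [log n ^ 3]. *)
Set Implicit Arguments.
Unset Strict Implicit.
Unset Printing Implicit Defensive.
Import Order.TTheory GRing.Theory Num.Theory.
Import numFieldNormedType.Exports.
Local Open Scope ring_scope.

(** * Rerouting a path through rotations with pivots moving away from its end *)

Section Rerouting.
Variables (V : finType) (g : rel V) (d : nat).
Implicit Types (R : {set V}) (s : seq (V * V)) (x : V).

Definition nbrs R : {set V} := [set w | [exists v in R, g v w]]%SET.

(** Half of the minimum degree is a gain that all but few vertices provide as
    long as [nbrs R] is a small fraction of the vertex set. *)
Definition fresh R b : bool :=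
  (d <= 2 * #|[set w | g b w && (w \notin nbrs R)]%SET|)%N.

(** [R] is the set of path ends reached so far. A pair [(a, b)] stands for a
    path edge with [b] closer to the end: if [a] has a neighbour in [R], a
    rotation with pivot [a] makes [b] an end. Only fresh [b] are recorded, so
    that each recorded end enlarges the neighbourhood substantially. *)
Definition grow R (ab : V * V) : {set V} :=
  if (ab.1 \in nbrs R) && fresh R ab.2 then (ab.2 |: R)%SET else R.

(** Some pair can serve as a last rotation that leaves a path end adjacent to
    the target [x]. *)
Fixpoint linked R x s : bool :=
  if s is ab :: s' then
    (ab.1 \in nbrs R) && g x ab.2 || linked (grow R ab) x s'
  else false.

(** A walk away from the path end is cut into disjoint edges, the nearer vertex
    of each edge coming first in the walk and second in the pair. *)
Fixpoint pairs (l : seq V) : seq (V * V) :=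
  if l is b :: a :: l' then (a, b) :: pairs l' else [::].

Variables (H : rel V) (Hsym : symmetric H) (gH : subrel g H).

(** A path starting at [h] is prolonged at its start by going back along [l]. *)
Lemma path_retreat (h : V) (l Q S : seq V) :
  path H h l -> path H h Q -> perm_eq (h :: Q) S ->
  exists Q', [/\ path H (last h l) Q', perm_eq (last h l :: Q') (l ++ S)
               & last (last h l) Q' = last h Q].
Proof.
move=> hl hQ pQ; case: (lastP l) hl => [|l' z] hl; first by exists Q.
exists (rev (h :: l') ++ Q); rewrite last_rcons.
have E : rev (h :: l') = rcons (rev l') h by rewrite rev_cons.
split.
- rewrite cat_path E last_rcons hQ andbT -E.
  have := rev_path H h (rcons l' z).
  rewrite last_rcons belast_rcons => ->.
  by rewrite (eq_path (e' := H)) // => u v; rewrite Hsym.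
- rewrite E cat_rcons -cat_cons -rev_rcons perm_cat //.
  by rewrite perm_rev.
- by rewrite last_cat E last_rcons.
Qed.

(** Pivots are met in the order in which they move away from the original end,
    so every rotation reverses only the part of the path already visited and
    leaves the rest in its original form. The invariant is that each member of
    [R] is the end of a path that starts at the current head [h] and covers the
    segment [S] visited so far: such a path is kept by prepending [b] and then
    [a], and turned into one ending at [b] by reversing it and prepending [a]. *)
Lemma reroute (h x : V) (S l : seq V) R : ~~ odd (size l) ->
  path H h l ->
  (forall r, r \in R ->
    exists Q, [/\ path H h Q, perm_eq (h :: Q) S & last h Q = r]) ->
  linked R x (pairs l) ->
  exists Q, [/\ path H (last h l) Q, perm_eq (last h l :: Q) (l ++ S)
              & g x (last (last h l) Q)].
Proof.
move: {2}(size l) (leqnn (size l)) => m.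
elim: m l h S R => [|m IH] [|b [|a l]] h S R //= szl ol /and3P[hb ba al] RQ.
have new : a \in nbrs R -> exists Q,
    [/\ path H a Q, perm_eq (a :: Q) (a :: b :: S) & last a Q = b].
  rewrite inE => /exists_inP[r rR ra].
  have [Q [hQ pQ lQ]] := RQ _ rR.
  exists (rcons (rev (h :: Q)) b); split; last by rewrite last_rcons.
  - rewrite rcons_path; apply/andP; split.
      have := rev_path H h Q; rewrite lQ => hr.
      rewrite lastI lQ rev_rcons /= Hsym gH //= hr.
      by rewrite (eq_path (e' := H)) // => u v; rewrite Hsym.
    by rewrite rev_cons last_rcons.
  - rewrite perm_cons perm_rcons perm_cons.
    by rewrite (perm_trans _ pQ) // perm_rev.
have old r : r \in R -> exists Q,
    [/\ path H a Q, perm_eq (a :: Q) (a :: b :: S) & last a Q = r].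
  move=> /RQ [Q [hQ pQ lQ]]; exists (b :: h :: Q).
  by rewrite /= Hsym ba Hsym hb hQ lQ !perm_cons pQ.
have fin l' S' : perm_eq (l' ++ a :: b :: S') (b :: a :: l' ++ S').
  by apply/seq.permP => P; rewrite /= !count_cat /=; lia.
case/orP.
- case/andP => aR xb; have [Q [hQ pQ lQ]] := new aR.
  have [Q' [hQ' pQ' lQ']] := path_retreat al hQ pQ.
  by exists Q'; rewrite lQ' lQ; split => //; apply: perm_trans pQ' (fin _ _).
- move=> lk.
  have szl' : (size l <= m)%N by lia.
  have ol' : ~~ odd (size l) by move: ol; rewrite negbK.
  have RQ' r : r \in grow R (a, b) -> exists Q,
      [/\ path H a Q, perm_eq (a :: Q) (a :: b :: S) & last a Q = r].
    rewrite /grow /=; case: ifP => [/andP[aR _]|_]; last exact: old.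
    by rewrite in_setU1 => /orP[/eqP->|/old]; first exact: new.
  have [Q [hQ pQ lQ]] := IH l a (a :: b :: S) _ szl' ol' al RQ' lk.
  by exists Q; split => //; apply: perm_trans pQ (fin _ _).
Qed.

End Rerouting.

(** * Sequential exposure of a uniformly random permutation *)

Section Exposure.
Variables (F : realFieldType) (V : finType) (n : nat) (cardV : #|V| = n).
Implicit Types (ps ls : seq V) (f : {perm V} -> F).

(** The permutations compatible with what has been revealed: the positions in
    [ps] carry the labels in [ls]. *)
Definition fiber ps ls : {set {perm V}} := [set t : {perm V} | map t ps == ls]%SET.

Lemma fiber_cons u ps a ls t :
  (t \in fiber (u :: ps) (a :: ls)) = (t u == a) && (t \in fiber ps ls).
Proof. by rewrite !inE /= eqseq_cons. Qed.

Lemma fiber_notin u ps ls (t : {perm V}) :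
  uniq (u :: ps) -> t \in fiber ps ls -> t u \notin ls.
Proof.
by rewrite inE => /andP[ups _] /eqP<-; rewrite mem_map //; apply: perm_inj.
Qed.

Lemma sum_fiber u ps ls f : uniq (u :: ps) ->
  \sum_(t in fiber ps ls) f t =
  \sum_(a | a \notin ls) \sum_(t in fiber (u :: ps) (a :: ls)) f t.
Proof.
move=> ups; rewrite (partition_big (fun t : {perm V} => t u) (fun a => a \notin ls)).
  by apply: eq_bigr => a _; apply: eq_bigl => t; rewrite fiber_cons andbC.
by move=> t; apply: fiber_notin.
Qed.

(** Composing with a transposition exchanges two labels that are still free. *)
Lemma card_fiber_swap u ps ls a b : uniq (u :: ps) ->
  a \notin ls -> b \notin ls ->
  (#|fiber (u :: ps) (a :: ls)| <= #|fiber (u :: ps) (b :: ls)|)%N.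
Proof.
move=> ups als bls; rewrite -(card_imset _ (@mulIg _ (tperm a b))).
apply/subset_leq_card/fintype.subsetP => _ /imsetP[t + ->].
rewrite !fiber_cons !inE permM => /andP[/eqP-> /eqP tps].
rewrite tpermL eqxx /= -tps; apply/eqP/eq_in_map => v vps.
rewrite permM tpermD //.
  by apply: contraNneq als => ->; rewrite -tps map_f.
by apply: contraNneq bls => ->; rewrite -tps map_f.
Qed.

Lemma card_notin ls : uniq ls -> #|[pred a | a \notin ls]| = (n - size ls)%N.
Proof.
move=> uls; have := cardC (mem ls); rewrite (card_uniqP uls) cardV => <-.
rewrite addKn.
by apply: eq_card => a; rewrite !inE.
Qed.

Lemma sum_notin (c : F) ls : uniq ls ->
  \sum_(a | a \notin ls) c = c *+ (n - size ls).
Proof. by move=> uls; rewrite sumr_const card_notin. Qed.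

(** The label of a new position is uniform among the free labels. *)
Lemma card_fiber_cons u ps ls a : uniq (u :: ps) -> uniq ls -> a \notin ls ->
  (#|fiber (u :: ps) (a :: ls)| * (n - size ls) = #|fiber ps ls|)%N.
Proof.
move=> ups uls als; rewrite -(card_notin uls) mulnC -sum_nat_const.
apply/eqP; rewrite eq_sym; apply/eqP.
rewrite -sum1_card (partition_big (fun t : {perm V} => t u) (fun a => a \notin ls)).
  apply: eq_bigr => b bls; rewrite sum1dep_card.
  transitivity #|fiber (u :: ps) (b :: ls)|.
    by apply: eq_card => t; rewrite fiber_cons [LHS]inE andbC.
  by apply/eqP; rewrite eqn_leq !card_fiber_swap.
by move=> t; apply: fiber_notin.
Qed.

(** The law of total expectation, for the label of one more position. *)
Lemma expose1 u ps ls f (B : V -> F) : uniq (u :: ps) -> uniq ls ->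
  size ls = size ps ->
  (forall a, a \notin ls -> \sum_(t in fiber (u :: ps) (a :: ls)) f t
     <= #|fiber (u :: ps) (a :: ls)|%:R * B a) ->
  \sum_(t in fiber ps ls) f t
     <= #|fiber ps ls|%:R * ((\sum_(a | a \notin ls) B a) / (n - size ls)%:R).
Proof.
move=> ups uls szs fB; rewrite (sum_fiber _ _ ups) mulr_suml mulr_sumr.
apply: ler_sum => a als; apply: le_trans (fB _ als) _.
rewrite -(card_fiber_cons ups uls als) natrM mulrACA.
have lsn : (0 < n - size ls)%N.
  by rewrite subn_gt0 szs -[X in (X <= _)%N]/(size (u :: ps)) -cardV -(card_uniqP ups) max_card.
by rewrite divff ?mulr1 // pnatr_eq0 -lt0n.
Qed.

Lemma expose2 u v ps ls f (B : V -> V -> F) : uniq (v :: u :: ps) -> uniq ls ->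
  size ls = size ps ->
  (forall a b, uniq (b :: a :: ls) ->
     \sum_(t in fiber (v :: u :: ps) (b :: a :: ls)) f t
     <= #|fiber (v :: u :: ps) (b :: a :: ls)|%:R * B a b) ->
  \sum_(t in fiber ps ls) f t <= #|fiber ps ls|%:R *
    ((\sum_(a | a \notin ls) \sum_(b | b \notin a :: ls) B a b)
       / ((n - size ls) * (n - (size ls).+1))%:R).
Proof.
move=> uvps uls szs fB; have ups : uniq (u :: ps) by case/andP: uvps.
set S := \sum_(a | _) _.
have -> : S / ((n - size ls) * (n - (size ls).+1))%:R = (\sum_(a | a \notin ls)
    ((\sum_(b | b \notin a :: ls) B a b) / (n - (size ls).+1)%:R))
    / (n - size ls)%:R.
  by rewrite -mulr_suml natrM invfM mulrA mulrAC.
apply: (expose1 (u := u)) => // a als.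
have uals : uniq (a :: ls) by rewrite /= als.
by apply: (expose1 (u := v)) => //= [|b bals]; [rewrite szs | apply: fB; rewrite cons_uniq bals].
Qed.

Lemma expose2_const u v ps ls f (c : F) : uniq (v :: u :: ps) -> uniq ls ->
  size ls = size ps ->
  (forall a b, uniq (b :: a :: ls) ->
     \sum_(t in fiber (v :: u :: ps) (b :: a :: ls)) f t
     <= #|fiber (v :: u :: ps) (b :: a :: ls)|%:R * c) ->
  \sum_(t in fiber ps ls) f t <= #|fiber ps ls|%:R * c.
Proof.
move=> uvps uls szs fc; apply: le_trans (expose2 uvps uls szs fc) _.
have E a : a \notin ls -> \sum_(b | b \notin a :: ls) c = c *+ (n - (size ls).+1).
  by move=> als; rewrite sum_notin //= als.
rewrite (eq_bigr _ E) sum_notin // -mulrnA mulnC -[c *+ _]mulr_natr mulfK //.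
have : (size (v :: u :: ps) <= n)%N by rewrite -cardV -(card_uniqP uvps) max_card.
by rewrite pnatr_eq0 -lt0n muln_gt0 !subn_gt0 szs /=; lia.
Qed.

(** An exponential moment bound: each exposed label multiplies [16 ^ count] by
    [16] with probability at most [D / m], hence on average by at most
    [1 + 15 * D / m]. *)
Lemma occupancy (Q : pred V) (D m : nat) pos ps ls : uniq (pos ++ ps) -> uniq ls ->
  size ls = size ps -> (#|Q| <= D)%N -> (0 < m)%N ->
  (m + size pos + size ls <= n.+1)%N ->
  \sum_(t in fiber ps ls) (16 ^ count Q (map t pos))%:R <=
  #|fiber ps ls|%:R * (1 + 15 * D%:R / m%:R) ^+ size pos :> F.
Proof.
move=> + + + QD m0; have m0R : 0 < m%:R :> F by rewrite ltr0n.
elim: pos ps ls => [|u pos IH] ps ls /= ups uls szs mn.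
  by rewrite sumr_const expr0 mulr1 expn0.
have /andP[upp upps] := ups.
have ups' : uniq (u :: ps).
  move: upp upps; rewrite mem_cat negb_or /= cat_uniq => /andP[_ ->].
  by case/and3P.
set q := 1 + _.
apply: le_trans (expose1 (B := fun a => (16 ^ Q a)%:R * q ^+ size pos) ups' uls szs _) _.
  move=> a als.
  have uals : uniq (a :: ls) by rewrite /= als.
  have pu : uniq (pos ++ u :: ps).
    by rewrite uniq_catC /= mem_cat orbC -mem_cat upp uniq_catC.
  rewrite mulrCA.
  apply: le_trans (ler_wpM2l _ (IH (u :: ps) (a :: ls) pu uals _ _)) => //.
  - rewrite mulr_sumr; apply: ler_sum => t; rewrite fiber_cons => /andP[/eqP-> _].
    by rewrite -natrM expnD.
  - by rewrite /= szs.
  - by rewrite /=; lia.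
rewrite ler_wpM2l // exprS -mulr_suml mulrAC ler_wpM2r //.
  by rewrite exprn_ge0 // addr_ge0 // divr_ge0 // mulr_ge0.
have lsn : (m <= n - size ls)%N.  by lia.
have lsn0 : 0 < (n - size ls)%:R :> F by rewrite ltr0n; lia.
rewrite ler_pdivrMr // /q mulrDl mul1r.
apply: (@le_trans _ _ ((n - size ls)%:R + 15 * D%:R)); last first.
  by rewrite lerD2l mulrAC ler_pdivlMr // ler_wpM2l ?mulr_ge0 // ler_nat.
have E a : (16 ^ Q a)%:R = 1 + 15 * (Q a)%:R :> F.
  by case: (Q a); rewrite /= ?expn1 ?expn0 ?mulr0 ?addr0 //; lra.
rewrite (eq_bigr _ (fun a _ => E a)) big_split /= sumr_const card_notin // lerD2l.
rewrite -mulr_sumr ler_wpM2l // -natr_sum ler_nat.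
apply: leq_trans QD; rewrite -sum1_card big_mkcond [leqRHS]big_mkcond /=.
by apply: leq_sum => a _; rewrite unfold_in; case: (a \notin ls); case: (Q a).
Qed.

End Exposure.

(** * One step of the exploration *)

Section Exploration.
Variables (V : finType) (g : rel V) (d : nat).
Implicit Types (R : {set V}) (ls : seq V).

(** The labels of the exposed positions use up at most a quarter of [d] of each
    neighbourhood; this prevents the process from exhausting the neighbourhood
    of the set of reached ends. *)
Definition spread (pos : seq V) (t : {perm V}) : bool :=
  [forall v, 4 * count (g v) (map t pos) <= d]%N.

Definition spread_on ls := forall v, (4 * count (g v) ls <= d)%N.

(** Freshness of the recorded ends guarantees the second inequality, which turns
    the bound on each single neighbourhood into one on [nbrs g R]. *)
Definition wide R := (d <= #|nbrs g R|)%N && (#|R| * d <= 2 * #|nbrs g R|)%N.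

Lemma nbrsU1 b R : nbrs g (b |: R) = ([set w | g b w] :|: nbrs g R)%SET.
Proof.
apply/setP => w; rewrite !inE; apply/exists_inP/orP.
  move=> [v]; rewrite !inE => /orP[/eqP->|vR] vw; first by left.
  by right; apply/exists_inP; exists v.
case=> [bw|/exists_inP[v vR vw]]; first by exists b => //; rewrite !inE eqxx.
by exists v => //; rewrite !inE vR orbT.
Qed.

Lemma nbrs1 a : nbrs g [set a] = [set w | g a w]%SET.
Proof.
apply/setP => w; rewrite !inE; apply/exists_inP/idP => [[v]|aw].
  by rewrite !inE => /eqP->.
by exists a; rewrite ?inE.
Qed.

Lemma card_nbrsU1 b R : #|nbrs g (b |: R)| =
  (#|[set w | g b w && (w \notin nbrs g R)]%SET| + #|nbrs g R|)%N.
Proof.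
rewrite nbrsU1 -[X in (_ + X)%N](cardsID [set w | g b w]%SET (nbrs g R)).
rewrite cardsU.
rewrite -(cardsID (nbrs g R) [set w | g b w]%SET).
have -> : ([set w | g b w && (w \notin nbrs g R)] =
  [set w | g b w] :\: nbrs g R)%SET by apply/setP => w; rewrite !inE andbC.
rewrite (setIC (nbrs g R)).
have := cardsID [set w | g b w]%SET (nbrs g R).
rewrite (setIC (nbrs g R)); lia.
Qed.

Lemma wide_grow R ab : wide R -> wide (grow g d R ab).
Proof.
rewrite /grow; case: ifP => // /andP[_]; rewrite /fresh => fr /andP[w1 w2].
apply/andP; rewrite card_nbrsU1; split; first lia.
have : (#|ab.2 |: R| <= #|R|.+1)%N by rewrite cardsU1; case: (_ \in _).
set c := #|_ |: _| => cR.
have : (c * d <= #|R|.+1 * d)%N by rewrite leq_mul2r cR orbT.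
rewrite mulSn; lia.
Qed.

Lemma card_set_in_seq (Q : pred V) ls : (#|[set w | Q w & w \in ls]%SET| <= count Q ls)%N.
Proof.
rewrite -size_filter; apply: leq_trans (card_size _).
by apply/subset_leq_card/fintype.subsetP => w; rewrite inE mem_filter.
Qed.

Lemma nbrs_used R ls : wide R -> spread_on ls ->
  (2 * #|[set w in nbrs g R | w \in ls]%SET| <= #|nbrs g R|)%N.
Proof.
move=> /andP[_ w2] sp.
have : (#|[set w in nbrs g R | w \in ls]%SET| <=
    \sum_(r in R) count (g r) ls)%N.
  have -> : [set w in nbrs g R | w \in ls]%SET =
      (\bigcup_(r in R) [set w | g r w & w \in ls])%SET.
    apply/setP => w; rewrite !inE; apply/andP/bigcupP.
      by case=> /exists_inP[r rR rw] wls; exists r; rewrite ?inE ?rw.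
    case=> r rR; rewrite inE => /andP[rw wls]; split => //.
    by apply/exists_inP; exists r.
  elim/big_rec2: _ => [|r m A _ Am]; first by rewrite cards0.
  by apply: leq_trans (leq_card_setU _ _) (leq_add (card_set_in_seq _ _) Am).
have : (4 * \sum_(r in R) count (g r) ls <= #|R| * d)%N.
  by rewrite big_distrr -sum_nat_const leq_sum.
lia.
Qed.

Lemma nbrs_grow_le R ab : (#|nbrs g R| <= #|nbrs g (grow g d R ab)|)%N.
Proof. by rewrite /grow; case: ifP => //; rewrite card_nbrsU1 leq_addl. Qed.

End Exploration.

(** Each index in [Q] saves [th] on the trivial bound [1]. *)
Lemma sum_gain (F : numDomainType) (V : finType) (P Q : pred V) (f : V -> F) (th : F) :
  (forall b, P b -> f b <= 1) -> (forall b, P b -> Q b -> f b <= 1 - th) ->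
  \sum_(b | P b) f b <= #|P|%:R - th * #|[pred b | P b & Q b]|%:R.
Proof.
move=> f1 fth; rewrite -!sum1_card !natr_sum mulr_sumr.
rewrite [X in _ - X]big_mkcond [leLHS]big_mkcond.
rewrite [X in X - _]big_mkcond /= -sumrB.
apply: ler_sum => b _; rewrite !unfold_in /=; case: ifP => Pb /=; last by rewrite subr0.
by case: ifP => Qb; rewrite ?mulr1 ?subr0; [apply: fth | apply: f1].
Qed.

Section StepEstimate.
Variables (F : realFieldType) (V : finType) (n : nat) (cardV : #|V| = n).
Variables (g : rel V) (gsym : symmetric g) (d kap : nat).
Hypothesis dmin : forall v, (d <= #|g v|)%N.
Hypothesis dmax : forall v, (#|g v| <= kap * d)%N.
Hypothesis (d4 : (4 <= d)%N) (kap0 : (0 < kap)%N).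
Implicit Types (R : {set V}) (ls : seq V).

(** A vertex that is not fresh sends more than [d / 2] edges into [nbrs g R],
    while that set receives at most [kap * d] edges per vertex. *)
Lemma card_not_fresh R :
  (#|[set b | ~~ fresh g d R b]%SET| <= 2 * kap * #|nbrs g R|)%N.
Proof.
have d0 : (0 < d)%N by lia.
rewrite -(leq_pmul2r d0).
set N := nbrs g R.
have S1 : (\sum_(b : V) #|[set w | g b w & w \in N]%SET| <= #|N| * (kap * d))%N.
  rewrite (eq_bigr (fun b => \sum_(w in N) g b w)%N); last first.
    move=> b _; rewrite -sum1dep_card big_mkcondl [RHS]big_mkcond [LHS]big_mkcond /=.
    by apply: eq_bigr => w _; case: (w \in N); case: (g b w).
  rewrite exchange_big /= -sum_nat_const; apply: leq_sum => w _.
  apply: leq_trans (dmax w); rewrite -sum1_card [leqRHS]big_mkcond /=.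
  by apply: leq_sum => b _; rewrite unfold_in gsym; case: (g w b).
apply: (@leq_trans (2 * \sum_(b : V) #|[set w | g b w & w \in N]%SET|)); last lia.
rewrite -sum_nat_const big_distrr /= big_mkcond /=.
apply: leq_sum => b _; rewrite inE; case: ifP => // /negPf; rewrite /fresh => /negbT.
rewrite -ltnNge -/N => nf.
have := dmin b; rewrite -cardsE -(cardsID N).
have -> : ([set x in g b] :&: N)%SET = [set w | g b w & w \in N]%SET.
  by apply/setP => w; rewrite !inE.
have -> : ([set x in g b] :\: N)%SET = [set w | g b w && (w \notin N)]%SET.
  by apply/setP => w; rewrite !inE andbC.
lia.
Qed.

(** The factor by which the potential [1 / #|nbrs g R|], counted as [0] once the
    target is reached, changes when the pair [(a, b)] is exposed. *)
Definition weight R x (a b : V) : F :=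
  if (a \in nbrs g R) && g x b then 0
  else #|nbrs g R|%:R / #|nbrs g (grow g d R (a, b))|%:R.

Lemma weight_le1 R x a b : wide g d R -> weight R x a b <= 1.
Proof.
move=> /andP[w1 _]; rewrite /weight; case: ifP => // _.
have le := nbrs_grow_le g d R (a, b).
by rewrite ler_pdivrMr ?mul1r ?ler_nat // ltr0n; lia.
Qed.

(** While [nbrs g R] is small, at least half of all [b] are fresh and enlarge it
    by [d / 2]; when it is large, at least [d / 2] values of [b] are adjacent to
    the target. Either way the total saving is of the order of
    [n * d / #|nbrs g R|]. *)
Lemma inner_sum R x a ls : wide g d R -> spread_on g d ls -> uniq (a :: ls) ->
  (4 * (size ls).+1 <= n)%N -> a \in nbrs g R ->
  \sum_(b | b \notin a :: ls) weight R x a b <=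
  (n - (size ls).+1)%:R - n%:R * d%:R / (16 * kap%:R * #|nbrs g R|%:R).
Proof.
move=> wR sp uals ln aR; have [w1 w2] := andP wR.
have M0 : 0 < #|nbrs g R|%:R :> F by rewrite ltr0n; lia.
have k0 : 0 < kap%:R :> F by rewrite ltr0n.
have dM : d%:R <= #|nbrs g R|%:R :> F by rewrite ler_nat.
have [small|big] := leqP (8 * kap * #|nbrs g R|) n.
(* In the first case few vertices are not fresh; in the second a constant
   fraction of all vertices is already adjacent to R. *)
- apply: le_trans (sum_gain (Q := fresh g d R)
    (th := d%:R / (4 * #|nbrs g R|%:R)) _ _) _.
  + by move=> b _; apply: weight_le1.
  + move=> b _ fb; rewrite /weight aR /=.
    have th1 : d%:R / (4 * #|nbrs g R|%:R) <= 1 :> F.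
      by rewrite ler_pdivrMr ?mulr_gt0 // mul1r; lra.
    case: ifP => _; first by rewrite subr_ge0.
    rewrite /grow /= aR fb /= card_nbrsU1 natrD.
    move: fb; rewrite /fresh -(ler_nat F) natrM; set fr := #|_|%:R => fb.
    have fr0 : 0 <= fr by [].
    move: M0 dM fb; set M := #|nbrs g R|%:R => M0 dM fb.
    have d0 : 0 <= d%:R :> F by [].
    rewrite ler_pdivrMr; last lra.
    suff : d%:R / (4 * M) * (fr + M) <= fr by rewrite mulrBl mul1r; lra.
    rewrite mulrAC ler_pdivrMr ?mulr_gt0 //; nra.
  + rewrite (card_notin cardV) //= lerD2l lerN2.
    have cB : (n <= 2 * #|[pred b | b \notin a :: ls & fresh g d R b]|)%N.
      have := card_not_fresh R.
      have := card_notin cardV uals; rewrite [size _]/= => E1.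
      have E2 : (#|[pred b | b \notin a :: ls]| <=
        #|[pred b | b \notin a :: ls & fresh g d R b]| +
        #|[set b | ~~ fresh g d R b]%SET|)%N.
        rewrite -!sum1_card big_mkcond [X in (_ <= X + _)%N]big_mkcond.
        rewrite [X in (_ <= _ + X)%N]big_mkcond -big_split /=.
        apply: leq_sum => b _; rewrite !inE.
        by case: (~~ _); case: (fresh _ _ _ _).
      lia.
    rewrite -(ler_nat F) natrM in cB.
    move: cB; set B := #|[pred b | _ & _]|%:R => cB.
    have d0 : 0 <= d%:R :> F by [].
    have k1 : 1 <= kap%:R :> F by rewrite ler1n.
    rewrite ler_pdivrMr ?mulr_gt0 //.
    have -> : d%:R / (4 * #|nbrs g R|%:R) * B * (16 * kap%:R * #|nbrs g R|%:R) =
      4 * d%:R * B * kap%:R by field; lra.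
    have : n%:R * d%:R <= 2 * B * d%:R by rewrite ler_wpM2r.
    have B0 : 0 <= B by [].
    have : 0 <= B * d%:R * (kap%:R - 1) by rewrite !mulr_ge0 // subr_ge0.
    have : 0 <= B * d%:R by rewrite mulr_ge0.
    lra.
- apply: le_trans (sum_gain (Q := g x) (th := 1) _ _) _.
  + by move=> b _; apply: weight_le1.
  + by move=> b _ xb; rewrite /weight aR xb subrr.
  + rewrite (card_notin cardV) //= lerD2l lerN2 mul1r.
    have cB : (d <= 2 * #|[pred b | b \notin a :: ls & g x b]|)%N.
      have spx := sp x; have dx := dmin x.
      have E2 : (#|g x| <= #|[pred b | b \notin a :: ls & g x b]| +
          #|[set w | g x w & w \in ls]%SET| + #|pred1 a|)%N.
        rewrite -!sum1_card big_mkcond [X in (_ <= X + _ + _)%N]big_mkcond.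
        rewrite [X in (_ <= _ + X + _)%N]big_mkcond [X in (_ <= _ + X)%N]big_mkcond.
        rewrite -!big_split /=.
        apply: leq_sum => b _; rewrite !inE.
        by rewrite [b \in g x]unfold_in; case: (g x b); case: (b == a); case: (b \in ls).
      have := card_set_in_seq (g x) ls; rewrite card1 in E2; lia.
    rewrite -(ler_nat F) natrM in cB; move: cB; set B := #|[pred b | _ & _]|%:R => cB.
    have bigR : n%:R < 8 * kap%:R * #|nbrs g R|%:R :> F.
      by rewrite -!natrM ltr_nat.
    rewrite ler_pdivrMr ?mulr_gt0 //.
    have d0 : 0 <= d%:R :> F by [].
    have B0 : 0 <= B by [].
    have n0 : 0 <= n%:R :> F by [].
    have : n%:R * d%:R <= (8 * kap%:R * #|nbrs g R|%:R) * (2 * B) by apply: ler_pM => //; lra.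
    lra.
Qed.

(** The events [a \in nbrs g R] have a total probability proportional to
    [#|nbrs g R|], which cancels the denominator of [inner_sum]: the expected
    potential decreases by a factor that does not depend on [R]. *)
Lemma outer_sum R x ls : wide g d R -> spread_on g d ls -> uniq ls ->
  (4 * (size ls).+1 <= n)%N ->
  \sum_(a | a \notin ls) \sum_(b | b \notin a :: ls) weight R x a b <=
  ((n - size ls) * (n - (size ls).+1))%:R * (1 - d%:R / (32 * kap%:R * n%:R)).
Proof.
move=> wR sp uls ln; have [w1 w2] := andP wR.
have M0 : 0 < #|nbrs g R|%:R :> F by rewrite ltr0n; lia.
have k0 : 0 < kap%:R :> F by rewrite ltr0n.
have n0 : 0 < n%:R :> F by rewrite ltr0n; lia.
have d0 : 0 < d%:R :> F by rewrite ltr0n; lia.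
set W1 := (n - (size ls).+1)%:R : F.
have W10 : 0 < W1 by rewrite ltr0n; lia.
pose psi : F := n%:R * d%:R / (16 * kap%:R * #|nbrs g R|%:R).
have psi0 : 0 < psi by rewrite divr_gt0 ?mulr_gt0.
rewrite -(ler_pM2r (x := W1^-1)) ?invr_gt0 // mulr_suml.
apply: le_trans (sum_gain (Q := [in nbrs g R]) (th := psi / W1) _ _) _.
- move=> a als; rewrite ler_pdivrMr // mul1r.
  have uals : uniq (a :: ls) by rewrite /= als.
  apply: le_trans (ler_sum _ (fun b _ => weight_le1 x a b wR)) _.
  by rewrite sumr_const (card_notin cardV).
- move=> a als aR; rewrite ler_pdivrMr // mulrBl mul1r divfK ?gt_eqF //.
  by apply: inner_sum => //; rewrite /= als.
have cA : (#|nbrs g R| <= 2 * #|[pred a | a \notin ls & a \in nbrs g R]|)%N.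
  have := nbrs_used wR sp.
  have := cardsID [set w | w \in ls]%SET (nbrs g R).
  have -> : (nbrs g R :&: [set w | w \in ls])%SET = [set w in nbrs g R | w \in ls]%SET.
    by apply/setP => w; rewrite !inE.
  have -> : #|(nbrs g R :\: [set w | w \in ls])%SET| = #|[pred a | a \notin ls & a \in nbrs g R]|.
    by apply: eq_card => w; rewrite !inE.
  lia.
rewrite -(ler_nat F) natrM in cA; rewrite (card_notin cardV) // natrM -/W1.
move: cA; set A := #|[pred a | _ & _]|%:R => cA.
set W0 := (n - size ls)%:R.
have -> : W0 * W1 * (1 - d%:R / (32 * kap%:R * n%:R)) / W1 =
   W0 - W0 * d%:R / (32 * kap%:R * n%:R) by field; lra.
rewrite lerD2l lerN2.
have W0n : W0 <= n%:R by rewrite ler_nat leq_subr.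
have W1n : W1 <= n%:R by rewrite ler_nat leq_subr.
have W00 : 0 <= W0 by [].
apply: (@le_trans _ _ (d%:R / (32 * kap%:R))).
  rewrite ler_pdivrMr ?mulr_gt0 //.
  rewrite (_ : d%:R / (32 * kap%:R) * (32 * kap%:R * n%:R) = n%:R * d%:R); last by field; lra.
  by rewrite ler_wpM2r // ltW.
apply: (@le_trans _ _ (psi / n%:R * A)); last first.
  by rewrite ler_wpM2r // ler_wpM2l ?(ltW psi0) // lef_pV2.
rewrite /psi (_ : _ / n%:R * A = d%:R * A / (16 * kap%:R * #|nbrs g R|%:R)); last first.
  by field; lra.
rewrite ler_pdivrMr ?mulr_gt0 // mulrAC ler_pdivlMr ?mulr_gt0 //.
have : 0 <= d%:R * kap%:R * (2 * A - #|nbrs g R|%:R).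
  by apply: mulr_ge0; [apply: mulr_ge0; apply: ltW | lra].
lra.
Qed.

End StepEstimate.

(** * The exploration almost never fails *)

Section Decay.
Variables (F : realFieldType) (n d kap : nat).

(** An upper bound for the expected factor by which the potential changes when a
    pair is exposed. *)
Definition decay : F := 1 - d%:R / (32 * kap%:R * n%:R).

Lemma decay_ge0 : (0 < d)%N -> (0 < kap)%N -> (d <= n)%N -> 0 <= decay.
Proof.
move=> d0 kap0 dn; rewrite /decay subr_ge0 -!natrM ler_pdivrMr.
  by rewrite mul1r ler_nat; apply: leq_trans dn _; rewrite leq_pmull // muln_gt0.
by rewrite ltr0n !muln_gt0 kap0 (leq_trans d0 dn).
Qed.

Lemma weight_cancel (N M M' c : F) : 0 < M -> 0 < M' ->
  N / M * c * (M / M') = N / M' * c.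
Proof. by move=> M0 M'0; field; rewrite (gt_eqF M0) (gt_eqF M'0). Qed.

End Decay.

Section Failure.
Variables (F : realFieldType) (V : finType) (n : nat) (cardV : #|V| = n).
Variables (g : rel V) (gsym : symmetric g) (d kap : nat).
Hypothesis dmin : forall v, (d <= #|g v|)%N.
Hypothesis dmax : forall v, (#|g v| <= kap * d)%N.
Hypothesis (d4 : (4 <= d)%N) (kap0 : (0 < kap)%N).
Implicit Types (R : {set V}) (ps ls : seq V).

Lemma spread_fiber pos l ps ls t : perm_eq pos (l ++ ps) -> t \in fiber ps ls ->
  spread g d pos t -> spread_on g d ls.
Proof.
move=> /(perm_map t) /seq.permP pp; rewrite inE => /eqP tps /forallP sp v.
by apply: leq_trans (sp v); rewrite pp map_cat count_cat tps leq_mul2l leq_addl.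
Qed.

(** The supermartingale estimate, by induction on the positions still hidden. At
    the end the potential of a failed exploration is at least [1 / n]. *)
Lemma exploration_fails (x : V) pos l ps ls R :
  ~~ odd (size l) -> perm_eq pos (l ++ ps) -> uniq (l ++ ps) -> uniq ls ->
  size ls = size ps -> (4 * (size ls + size l).+1 <= n)%N -> (d <= n)%N ->
  wide g d R ->
  \sum_(t in fiber ps ls)
    (spread g d pos t && ~~ linked g d R x (pairs (map t l)))%:R
  <= #|fiber ps ls|%:R * (n%:R / #|nbrs g R|%:R * decay F n d kap ^+ (size l)./2) :> F.
Proof.
have [k sk] := ubnP (size l); elim: k l sk ps ls R => // k IH l sk ps ls R.
move=> ol pp ul uls szs ln dn wR.
have M0 : 0 < #|nbrs g R|%:R :> F.
  by rewrite ltr0n; case/andP: wR => w _; apply: leq_trans w; lia.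
have n0 : 0 < n%:R :> F by rewrite ltr0n; lia.
have decay0 : 0 <= decay F n d kap by apply: decay_ge0 => //; lia.
have [/existsP[t0 /andP[t0f sp0]]|none] :=
    boolP [exists t, (t \in fiber ps ls) && spread g d pos t]; last first.
  rewrite big1 => [|t tf]; first by rewrite !mulr_ge0 ?invr_ge0 ?exprn_ge0 // ltW.
  case: (boolP (spread _ _ _ _)) => // sp.
  by case/existsP: none; exists t; rewrite tf.
have sp := spread_fiber pp t0f sp0.
case: l sk ol pp ul ln => [|v [|u l]] // sk ol pp ul ln.
  rewrite /= expr0 mulr1 mulrC mulr_natr -sumr_const.
  apply: ler_sum => t _; rewrite andbT; apply: (@le_trans _ _ 1).
    by case: (spread _ _ _ _).
  by rewrite ler_pdivlMr // mul1r ler_nat -cardV max_card.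
rewrite -[(size _)./2]/((size l)./2.+1).
have ol' : ~~ odd (size l) by move: ol; rewrite /= negbK.
rewrite /= in sk ln.
have sk' : (size l < k)%N by clear ol pp ul; lia.
have d0 : (0 < d)%N by clear ol pp ul; lia.
have ln1 : (4 * (size ls).+1 <= n)%N by clear ol pp ul; lia.
have W0 : 0 < ((n - size ls) * (n - (size ls).+1))%:R :> F.
  by rewrite ltr0n muln_gt0 !subn_gt0; clear ol pp ul; lia.
have perml : perm_eq (v :: u :: l ++ ps) (l ++ v :: u :: ps).
  by rewrite perm_sym (perm_catCA l [:: v; u] ps).
have uvu : uniq (v :: u :: ps).
  move: ul; rewrite -[X in is_true X]/(uniq (v :: u :: l ++ ps)).
  by rewrite (perm_uniq perml) cat_uniq => /and3P[].
pose B (a b : V) : F := n%:R / #|nbrs g R|%:R * decay F n d kap ^+ (size l)./2 * weight F g d R x a b.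
apply: le_trans (expose2 (B := B) cardV uvu uls szs _) _.
  move=> a b ubals; rewrite /B /weight.
  have step t : t \in fiber (v :: u :: ps) (b :: a :: ls) ->
      linked g d R x (pairs (map t (v :: u :: l))) =
      (a \in nbrs g R) && g x b ||
      linked g d (grow g d R (a, b)) x (pairs (map t l)).
    by rewrite !fiber_cons => /and3P[/eqP tv /eqP tu _]; rewrite /= tv tu.
  case: ifP => hit.
    by rewrite mulr0 mulr0 big1 // => t tf; rewrite step // hit andbF.
  have wR' : wide g d (grow g d R (a, b)) by apply: wide_grow.
  have M'0 : 0 < #|nbrs g (grow g d R (a, b))|%:R :> F.
    by rewrite ltr0n; case/andP: wR' => w _; apply: leq_trans w.
  rewrite (weight_cancel _ _ M0 M'0).
  have pp' := perm_trans pp perml.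
  have ul' : uniq (l ++ [:: v, u & ps]) by rewrite -(perm_uniq perml).
  have szs' : size [:: b, a & ls] = size [:: v, u & ps] by rewrite /= szs.
  have ln' : (4 * (size [:: b, a & ls] + size l).+1 <= n)%N by rewrite /= addSnnS addSnnS.
  apply: le_trans (IH l sk' _ _ _ ol' pp' ul' ubals szs' ln' dn wR').
  by apply: ler_sum => t tf; rewrite (step t tf) hit.
rewrite ler_wpM2l // /B.
under eq_bigr => a _ do rewrite -mulr_sumr.
rewrite -mulr_sumr -!mulrA ler_wpM2l ?(ltW n0) // ler_wpM2l ?invr_ge0 ?(ltW M0) //.
rewrite exprSr ler_wpM2l ?exprn_ge0 //.
by rewrite ler_pdivrMr // mulrC; apply: outer_sum.
Qed.

Lemma fiber_nil : @fiber V [::] [::] = [set: {perm V}]%SET.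
Proof. by apply/setP => t; rewrite !inE eqxx. Qed.

(** A failure means that the exposed labels are badly spread, which [occupancy]
    makes unlikely, or that the potential has survived all [m] pairs. *)
Lemma linked_fails (p x : V) l m : uniq (p :: x :: l) -> size l = (2 * m)%N ->
  (8 * (m + 3) <= n)%N -> (d <= n)%N ->
  \sum_(t : {perm V}) (~~ linked g d [set t p]%SET (t x) (pairs (map t l)))%:R
  <= (#|{perm V}|)%:R * (n%:R * decay F n d kap ^+ m
     + n%:R / 2 ^+ d * (1 + 30 * (kap * d)%:R / n%:R) ^+ (2 * m + 2)) :> F.
Proof.
move=> ul szl mn dn; have n0 : 0 < n%:R :> F by rewrite ltr0n; lia.
have sumT (f : {perm V} -> F) : \sum_t f t = \sum_(t in @fiber V [::] [::]) f t.
  by apply: eq_bigl => t; rewrite fiber_nil inE.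
have cardT : #|{perm V}|%:R = #|@fiber V [::] [::]|%:R :> F.
  by rewrite fiber_nil cardsT.
set pos := p :: x :: l.
apply: (@le_trans _ _ (\sum_(t : {perm V})
   ((spread g d pos t && ~~ linked g d [set t p]%SET (t x) (pairs (map t l)))%:R
    + (~~ spread g d pos t)%:R))).
  by apply: ler_sum => t _; case: (spread _ _ _ _); case: (linked _ _ _ _ _);
    rewrite /= ?addr0 ?add0r ?ler01.
rewrite big_split /= mulrDr; apply: lerD.
- rewrite sumT cardT.
  have uxp : uniq [:: x; p].
    by rewrite /= !inE eq_sym; move: ul; rewrite /= !inE negb_or => /andP[/andP[-> _] _].
  have pp : perm_eq pos (l ++ [:: x; p]).
    by apply/seq.permP => P; rewrite /= !count_cat /=; lia.
  apply: le_trans (expose2_const (c := n%:R * decay F n d kap ^+ m) cardV uxp _ _ _) _ => //.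
    move=> a b uba.
    have wR : wide g d [set a]%SET.
      rewrite /wide nbrs1 cards1 mul1n cardsE; have := dmin a.
      by move=> da; apply/andP; split; lia.
    have := @exploration_fails b pos l [:: x; p] [:: b; a] [set a]%SET.
    move=> /(_ _ pp _ uba erefl _ dn wR) H.
    apply: le_trans (le_trans _ (H _ _ _)) _.
    + apply: ler_sum => t; rewrite !fiber_cons => /and3P[/eqP-> /eqP-> _]; exact: lexx.
    + by rewrite szl mul2n odd_double.
    + by rewrite -(perm_uniq pp).
    + by rewrite szl /=; lia.
    + rewrite ler_wpM2l // szl mul2n doubleK ler_wpM2r //.
        by rewrite exprn_ge0 // decay_ge0 //; lia.
      rewrite ler_pdivrMr ?ler_peMr ?ler1n ?ltr0n //;
      by case/andP: wR => w _; apply: leq_trans w; lia.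
- rewrite sumT cardT.
  have d2 : 0 < 2 ^+ d :> F by rewrite exprn_gt0.
  (* A vertex with 4 * count > d contributes 16 ^ count >= 2 ^ d. *)
  have M t : (~~ spread g d pos t)%:R <=
      (\sum_(v : V) (16 ^ count (g v) (map t pos))%:R) / 2 ^+ d :> F.
    rewrite ler_pdivlMr //; case: (boolP (spread _ _ _ _)) => [_|].
      by rewrite mul0r sumr_ge0.
    rewrite negb_forall => /existsP[v]; rewrite -ltnNge => dv.
    rewrite mul1r (bigD1 v) //= ler_wpDr ?sumr_ge0 // -natrX ler_nat.
    by rewrite (_ : 16 = 2 ^ 4)%N // -expnM leq_exp2l // ltnW.
  apply: le_trans (ler_sum _ (fun t _ => M t)) _.
  rewrite -mulr_suml exchange_big /= mulrAC mulrA ler_wpM2r ?invr_ge0 ?(ltW d2) //.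
  pose q : F := 1 + 30 * (kap * d)%:R / n%:R.
  apply: (@le_trans _ _ (\sum_(v : V) #|@fiber V [::] [::]|%:R * q ^+ (2 * m + 2))).
    apply: ler_sum => v _.
    have m0 : (0 < n - (size pos))%N by rewrite /= szl; lia.
    apply: le_trans (@occupancy F V n cardV (g v) (kap * d) (n - size pos) pos [::] [::] _ _ _ _ m0 _) _ => //.
    - by rewrite cats0.
    - by rewrite /=; lia.
    rewrite ler_wpM2l // (_ : size pos = 2 * m + 2)%N; last by rewrite /= szl; lia.
    apply: lerXn2r; rewrite ?nnegrE.
    + by rewrite addr_ge0 // divr_ge0 // mulr_ge0.
    + by rewrite addr_ge0 // divr_ge0 // mulr_ge0.
    + rewrite lerD2l ler_pdivlMr // mulrAC ler_pdivrMr; last by rewrite ltr0n; lia.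
      rewrite -!natrM ler_nat mulnAC [leqRHS]mulnAC leq_mul2r; lia.
  by rewrite sumr_const cardV -[_ *+ n]mulr_natr -mulrA (mulrC (q ^+ _)).
Qed.

End Failure.

(** * Relabelling graphs, and orienting 2-regular graphs *)

Section Relabelling.
Variable T : finType.
Implicit Types (F : sgraph T) (t s : {perm T}) (x y z : T).

Lemma adjC F : symmetric (adj F).
Proof. by move=> x y; rewrite /adj finset.setUC. Qed.

Lemma adj_irr F x : adj F x x = false.
Proof.
apply/negP => xx; have := forall_inP (edges_card2 F) _ xx.
by rewrite finset.setUid cards1.
Qed.

Lemma imset_set2 t x y : (t @: [set x; y] = [set t x; t y])%SET.
Proof. by rewrite imsetU1 imset_set1. Qed.

Lemma relabel_card2 t F :
  [forall e in [set t @: (e : {set T}) | e in edges F]%SET, #|e| == 2%N].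
Proof.
apply/forall_inP => _ /imsetP[e eF ->]; rewrite card_imset; last exact: perm_inj.
exact: (forall_inP (edges_card2 F)).
Qed.

Definition relabel t F : sgraph T := SGraph (relabel_card2 t F).

Lemma adj_relabel t F x y : adj (relabel t F) (t x) (t y) = adj F x y.
Proof.
by rewrite /adj /= -imset_set2 mem_imset //; apply/imset_inj/perm_inj.
Qed.

Lemma relabel_inj t : injective (relabel t).
Proof.
move=> F F' /(congr1 (@edges T)) /= E; apply: val_inj => /=.
by apply: imset_inj E; apply/imset_inj/perm_inj.
Qed.

Lemma deg_relabel t F x : deg (relabel t F) (t x) = deg F x.
Proof.
rewrite /deg -(card_imset [pred y | adj F x y] (@perm_inj _ t)).
apply: eq_card => y; rewrite inE; apply/idP/imsetP => [|[z + ->]].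
  by move=> xy; exists (t^-1%g y); rewrite ?permKV // inE -(adj_relabel t) permKV.
by rewrite inE adj_relabel.
Qed.

Lemma regular_relabel k t F : regular k (relabel t F) = regular k F.
Proof.
apply/forallP/forallP => reg x; first by rewrite -(deg_relabel t).
by rewrite -(permKV t x) deg_relabel.
Qed.

(** A uniformly random member of a class closed under relabelling may be
    relabelled by an independent random permutation. *)
Lemma relabel_average (A B : pred (sgraph T)) :
  (forall t F, A (relabel t F) = A F) ->
  (#|{perm T}| * #|[pred F | A F & B F]| =
   \sum_(F | A F) #|[set t : {perm T} | B (relabel t F)]%SET|)%N.
Proof.
move=> Ainv; transitivity (\sum_(t : {perm T}) #|[pred F | A F & B F]|)%N.
  by rewrite sum_nat_const.
under [RHS]eq_bigr => F _ do rewrite -sum1dep_card big_mkcond /=.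
rewrite exchange_big /=; apply: eq_bigr => t _.
rewrite -sum1_card (reindex_inj (@relabel_inj t)) /=.
rewrite big_mkcond [RHS]big_mkcond /=; apply: eq_bigr => F _.
by rewrite !inE Ainv; case: (A F).
Qed.

End Relabelling.

Section Orientation.
Variable T : finType.
Implicit Types (F : sgraph T) (t s : {perm T}) (x y z : T).

(** The graph whose edges join each [x] to [s x]. *)
Definition orients s F : bool :=
  [forall x, forall y, adj F x y == (y == s x) || (x == s y)].

Lemma orientsP s F : reflect (forall x y, adj F x y = (y == s x) || (x == s y))
  (orients s F).
Proof.
apply: (iffP forallP) => [E x y|E x]; first by apply/eqP; move: y; apply/forallP.
by apply/forallP => y; rewrite E.
Qed.

(** The neighbour of [y] by which a walk entering from [x] leaves. *)
Lemma deg2P F x y : deg F y = 2%N -> adj F y x ->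
  exists2 z, z != x & forall w, adj F y w = (w == x) || (w == z).
Proof.
rewrite /deg => d2 yx; move: d2; rewrite (cardD1 x) inE yx => -[/mem_card1[z Ez]].
have := Ez z; rewrite !inE eqxx => /andP[zx yz]; exists z => // w.
have := Ez w; rewrite !inE; case: eqVneq => [->|wx] /=; first by rewrite yx.
by move->.
Qed.

Lemma orients_neq2 s F : regular 2 F -> orients s F -> forall x, s (s x) != x.
Proof.
move=> /forallP reg /orientsP E x; apply/eqP => ssx.
have xs : adj F x (s x) by rewrite E eqxx.
have [z zs Ez] := deg2P (eqP (reg x)) xs.
have := Ez z; rewrite eqxx orbT E (negPf zs) /= => /eqP xz.
by move: zs; rewrite -(inj_eq (@perm_inj _ s)) -xz ssx eqxx.
Qed.

Section DartWalk.
Variable F : sgraph T.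
Hypothesis reg : regular 2 F.

(** Darts are oriented edges; [walk] continues straight on to the next dart. *)
Definition dart (p : T * T) := adj F p.1 p.2.
Definition turn (p : T * T) : T * T := (p.2, p.1).
(** On the darts of a 2-regular graph the default value [p.1] is never taken. *)
Definition walk (p : T * T) : T * T :=
  (p.2, odflt p.1 [pick z | adj F p.2 z && (z != p.1)]).

Lemma turnK : involutive turn. Proof. by case. Qed.

Lemma dart_turn p : dart (turn p) = dart p.
Proof. by rewrite /dart /= adjC. Qed.

Lemma walkP p : dart p -> exists z, [/\ walk p = (p.2, z), z != p.1 &
  forall w, adj F p.2 w = (w == p.1) || (w == z)].
Proof.
case: p => x y xy; have yx : adj F y x by rewrite adjC.
have [z zx Ez] := deg2P (eqP (forallP reg y)) yx.
exists z; split=> //; rewrite /walk /=; case: pickP => /= [w|/(_ z)].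
  by rewrite Ez; case: eqVneq => //= wx /andP[/eqP->].
by rewrite Ez eqxx orbT zx.
Qed.

Lemma dart_walk p : dart p -> dart (walk p).
Proof. by move=> /walkP[z [-> _ Ez]]; rewrite /dart Ez eqxx orbT. Qed.

Lemma walk_turn_walk p : dart p -> walk (turn (walk p)) = turn p.
Proof.
move=> pd; have [z [E zx Ez]] := walkP pd.
have zd : dart (turn (walk p)) by rewrite dart_turn dart_walk.
have [w [-> wz Ew]] := walkP zd; move: wz Ew; rewrite E /= => wz Ew.
have := Ew p.1; rewrite Ez eqxx eq_sym (negPf zx) /= => /esym/eqP <-.
by [].
Qed.

Lemma dart_iter k p : dart p -> dart (iter k walk p).
Proof. by move=> pd; elim: k => //= k; apply: dart_walk. Qed.

Lemma iter_turn k p : dart p -> iter k walk (turn (iter k walk p)) = turn p.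
Proof.
move=> pd; elim: k => //= k IH.
by rewrite -iterS iterSr walk_turn_walk // dart_iter.
Qed.

(** Moving one step on one side and one step back on the other reduces the claim
    to the cases [q = turn q] and [q = turn (walk q)], excluded because the
    graph has no loop and the walk never goes back. *)
Lemma walk_not_turn p i j : dart p -> iter i walk p <> turn (iter j walk p).
Proof.
move=> pd; set k := (i + j)./2.
have shift m i' j' : iter i' walk p = turn (iter (m + j') walk p) ->
    iter (m + i') walk p = turn (iter j' walk p).
  rewrite iterD => E.
  by rewrite [LHS]iterD E iter_turn // dart_iter.
move=> E.
have E0 : iter 0 walk p = turn (iter (i + j) walk p).
  by rewrite addnC (shift j i 0) ?turnK ?addn0.
have kk : (i + j = k + (odd (i + j) + k))%N.
  by rewrite -{1}(odd_double_half (i + j)) -/k -addnn; lia.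
rewrite {1}kk in E0; move/shift: E0; rewrite addn0 => E0.
have qd := dart_iter k pd; move: E0 qd; case: (odd _); rewrite /= ?add0n;
  move: (iter k walk p) => q E0 qd.
  have [z [wq zq _]] := walkP qd; move: E0; rewrite wq => /(congr1 fst) /= qz.
  by rewrite qz eqxx in zq.
by have := qd; rewrite /dart {2}E0 /= adj_irr.
Qed.

(** A set of darts closed under [walk] that chooses at most one of the two
    directions of each edge. *)
Definition coherent (D : {set T * T}) : bool :=
  [forall p in D, [&& dart p, walk p \in D & turn p \notin D]].

(** In a maximal coherent set no edge is left out: by [walk_not_turn] the forward
    walk of a missing dart could be added. *)
Lemma coherent_half : exists2 D, coherent D &
  forall p, dart p -> (p \in D) || (turn p \in D).
Proof.
have [|D /maxsetP[coh maxO]] := @ex_maxset _ (fun D => coherent D).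
  by exists set0; apply/forall_inP => p; rewrite inE.
exists D => // p pd; apply/norP => -[pO tO].
have cohP q := forall_inP coh q.
have iterO k q : q \in D -> iter k walk q \in D.
  by move=> qO; elim: k => //= k /cohP/and3P[].
pose D' := (D :|: [set q | fconnect walk p q])%SET.
suff coh' : coherent D'.
  move: (pO); rewrite -(maxO _ coh' (finset.subsetUl _ _)).
  by rewrite !inE connect0 orbT.
apply/forall_inP => q; rewrite !inE => /orP[qO|pq].
  have /and3P[qd wO tqO] := cohP _ qO; rewrite qd wO (negPf tqO) /=.
  apply/negP => /iter_findex E; case/negP: tO.
  have -> : turn p = iter (findex walk p (turn q)) walk q.
    by rewrite -(iter_turn (findex walk p (turn q)) pd) E turnK.
  exact: iterO.
have E := iter_findex pq; rewrite -E dart_iter //= -iterS fconnect_iter orbT /=.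
apply/norP; split; apply/negP.
  move=> /(iterO (findex walk p q)); rewrite iter_turn //; exact/negP.
by move=> /iter_findex /esym /esym; apply: walk_not_turn.
Qed.

(** The darts of a coherent choice of directions form the graph of a
    permutation. *)
Lemma orientation_exists : exists s, orients s F.
Proof.
have [D /forall_inP coh half] := coherent_half.
have pull p : dart p -> walk p \in D -> p \in D.
  move=> pd wO.
  have inj : {in D &, injective walk}.
    move=> q r /coh/and3P[qd _ _] /coh/and3P[rd _ _] E.
    by apply: (can_inj turnK); rewrite -(walk_turn_walk qd) E walk_turn_walk.
  have im : (walk @: D = D)%SET.
    apply/eqP; rewrite eqEcard (card_in_imset inj) leqnn andbT.
    by apply/fintype.subsetP => _ /imsetP[q /coh/and3P[_ ? _] ->].
  move: wO; rewrite -{1}im => /imsetP[q qO E]; have /and3P[qd _ _] := coh _ qO.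
  suff -> : p = q by [].
  by apply: (can_inj turnK); rewrite -(walk_turn_walk pd) E walk_turn_walk.
pose next x := odflt x [pick y | (x, y) \in D].
have nextO x : (x, next x) \in D.
  rewrite /next; case: pickP => //= none.
  have : (0 < deg F x)%N by rewrite (eqP (forallP reg x)).
  move=> /card_gt0P[y]; rewrite inE => xy.
  have yd : dart (y, x) by rewrite /dart adjC.
  have := half _ yd; rewrite [(x, y) \in D]none orbF => /coh/and3P[_ + _].
  by have [z [-> _ _]] := walkP yd; rewrite /= none.
have nextU x y : (x, y) \in D -> y = next x.
  move=> xyO; apply/eqP/contraT => yn.
  have /and3P[xyd _ tO] := coh _ xyO; case/negP: tO.
  have yd : dart (turn (x, y)) by rewrite dart_turn.
  apply: pull => //; have [z [-> zy Ez]] := walkP yd.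
  have /and3P[xn _ _] := coh _ (nextO x).
  have := Ez (next x); rewrite [adj _ _ _]xn /= [next x == y]eq_sym (negPf yn) /=.
  by move=> /esym/eqP <-; apply: nextO.
have nextI : injective next.
  move=> x x' E; apply/eqP/contraT => xx'.
  have /and3P[xd wO _] := coh _ (nextO x).
  have /and3P[xd' _ tO'] := coh _ (nextO x').
  case/negP: tO'; have [z [E' zx Ez]] := walkP xd.
  move: wO; rewrite E' /turn -E /=.
  suff -> : x' = z by [].
  have := Ez x'; rewrite /= eq_sym (negPf xx') E [adj _ _ _]adjC.
  by rewrite -[adj _ _ _]/(dart (x', next x')) xd' => /esym/eqP.
exists (perm nextI); apply/orientsP => x y; rewrite !permE.
apply/idP/orP => [xy|[/eqP->|/eqP->]].
- by have /orP[/nextU<-|yx] := half (x, y) xy; [left|right; rewrite -(nextU y x yx)].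
- by have /and3P[] := coh _ (nextO x).
- by have /and3P[] := coh _ (nextO y); rewrite /dart adjC.
Qed.

End DartWalk.
End Orientation.

(** * Most 2-regular graphs have few cycles *)

Section CycleCount.
Variable T : finType.
Implicit Types (F : sgraph T) (t s : {perm T}) (x y z : T) (A : {set {set T}}).

Lemma porbit_step s x : porbit s (s x) = porbit s x.
Proof.
by apply/eqP; rewrite eq_porbit_mem -{1}(expg1 s) mem_porbit.
Qed.

Lemma porbit_stepV s x : porbit s (s^-1%g x) = porbit s x.
Proof. by rewrite -[in RHS](permKV s x) porbit_step. Qed.

Lemma eq_permV s x y : (x == s y) = (y == s^-1%g x).
Proof. by rewrite -[RHS](inj_eq (@perm_inj _ s)) permKV eq_sym. Qed.

Definition flip_fun s A x : T :=
  if porbit s x \in A then s^-1%g x else s x.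

Lemma porbit_flip s A x : porbit s (flip_fun s A x) = porbit s x.
Proof. by rewrite /flip_fun; case: ifP; rewrite ?porbit_stepV ?porbit_step. Qed.

Lemma flip_inj s A : injective (flip_fun s A).
Proof.
move=> x y E; have := porbit_flip s A x; rewrite E porbit_flip => oxy.
by move: E; rewrite /flip_fun oxy; case: ifP => _ /perm_inj.
Qed.

(** The orientation in which the cycles belonging to [A] are reversed. *)
Definition flip s A : {perm T} := perm (@flip_inj s A).

Lemma orients_flip s A F : orients s F -> orients (flip s A) F.
Proof.
move=> /orientsP E; apply/orientsP => x y; rewrite E !permE.
have [oxy|oxy] := eqVneq (porbit s x) (porbit s y).
  rewrite /flip_fun oxy; case: ifP => // _.
  by rewrite eq_permV [x == s y]eq_permV orbC.
have ne B u v : porbit s u != porbit s v -> (v == flip_fun s B u) = false.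
  move=> uv; apply: contraNF uv => /eqP->; by rewrite porbit_flip.
have ne' u v : porbit s u != porbit s v -> (v == s u) = false.
  by move=> uv; apply: contraNF uv => /eqP->; rewrite porbit_step.
by rewrite !ne ?ne' // eq_sym.
Qed.

(** Every cycle has length at least three, so it has two distinct orientations,
    which can be chosen independently. *)
Lemma card_orientations s F : regular 2 F -> orients s F ->
  (2 ^ #|porbits s| <= #|[set s' | orients s' F]%SET|)%N.
Proof.
move=> reg oF; rewrite -card_powerset -(card_in_imset (f := flip s)).
  apply/subset_leq_card/fintype.subsetP => _ /imsetP[A _ ->].
  by rewrite inE orients_flip.
have sub A B : A \in powerset (porbits s) -> flip s A = flip s B -> A \subset B.
  rewrite inE => /fintype.subsetP As E; apply/fintype.subsetP => C CA.
  have /imsetP[x _ Cx] := As _ CA; apply/contraT => CB.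
  have := congr1 (fun p : {perm T} => p x) E.
  rewrite !permE /flip_fun -Cx CA (negPf CB) => sx.
  by have := orients_neq2 reg oF x; rewrite -sx permKV eqxx.
move=> A B As Bs E; apply/eqP; rewrite eqEsubset; apply/andP.
by split; [apply: sub E | apply: sub (esym E)].
Qed.

Definition orientation F : {perm T} := odflt 1%g [pick s | orients s F].

Lemma orientationP F : regular 2 F -> orients (orientation F) F.
Proof.
move=> reg; rewrite /orientation; case: pickP => // none.
by have [s] := orientation_exists reg; rewrite none.
Qed.

Lemma orients_fun s F F' : orients s F -> orients s F' -> F = F'.
Proof.
move=> /orientsP E /orientsP E'; apply: val_inj; apply/setP => e /=.
have [/cards2P[x [y [_ ->]]]|e2] := boolP (#|e| == 2%N).
  by have := E x y; rewrite -E' /adj.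
by apply/idP/idP => /(forall_inP (edges_card2 _)); rewrite (negPf e2).
Qed.

(** Distinct graphs have disjoint sets of orientations. *)
Lemma many_cycles k :
  (#|[pred F : sgraph T | regular 2 F & k <= #|porbits (orientation F)|]| * 2 ^ k
   <= #|{perm T}|)%N.
Proof.
rewrite -sum_nat_const.
apply: (@leq_trans (\sum_(F : sgraph T | regular 2 F) #|[set s | orients s F]%SET|)).
  rewrite big_mkcond [leqRHS]big_mkcond /=; apply: leq_sum => F _.
  rewrite !inE; case: (boolP (regular 2 F)) => //= reg; case: ifP => // kF.
  by apply: leq_trans (card_orientations reg (orientationP reg)); rewrite leq_exp2l.
under eq_bigr => F _ do rewrite -sum1dep_card big_mkcond /=.
rewrite exchange_big /= -sum1_card; apply: leq_sum => s _.
rewrite -big_mkcondr /= sum1dep_card.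
apply/card_le1_eqP => F F'; rewrite !inE => /andP[_ o1] /andP[_ o2].
exact: orients_fun o2 o1.
Qed.

End CycleCount.

(** The relabelled copies of a single spanning cycle already give enough
    2-regular graphs. *)
Section HamiltonCycles.
Variables (T : finType) (s : {perm T}) (o : T).
Hypothesis s1 : forall x, s x != x.
Hypothesis s2 : forall x, s (s x) != x.
Hypothesis trans : forall x, exists i, x = iter i s o.

Lemma cycle_card2 :
  [forall e in [set [set x; s x] | x : T]%SET, #|e| == 2%N].
Proof. by apply/forall_inP => _ /imsetP[x _ ->]; rewrite cards2 [x == _]eq_sym s1. Qed.

Definition cycle_graph : sgraph T := SGraph cycle_card2.

Lemma orients_cycle_graph : orients s cycle_graph.
Proof.
apply/orientsP => x y; rewrite /adj /=; apply/imsetP/orP.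
  case=> z _ /setP E; have := E x; have := E y; rewrite !inE !eqxx orbT /=.
  move=> /esym/orP[]/eqP yz /esym/orP[]/eqP xz; rewrite ?yz ?xz ?eqxx; try by auto.
    have := E (s z); rewrite !inE eqxx orbT xz yz orbb.
    by rewrite (negPf (s1 z)).
  have := E z; rewrite !inE eqxx xz yz orbb /=.
  by rewrite eq_sym (negPf (s1 z)).
by case=> /eqP->; [exists x | exists y => //; rewrite finset.setUC].
Qed.

Lemma regular_cycle_graph : regular 2 cycle_graph.
Proof.
apply/forallP => x; rewrite /deg.
rewrite (eq_card (B := [set s x; s^-1%g x]%SET)) => [|y].
  by rewrite cards2 -(inj_eq (@perm_inj _ s)) permKV s2.
rewrite !inE (orientsP _ _ orients_cycle_graph).
by rewrite [x == s y]eq_permV.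
Qed.

(** A relabelling of the cycle is determined by the resulting graph and by the
    labels of two consecutive vertices: the labels of the others follow by
    walking along the cycle. *)
Lemma card_regular2_ge :
  (#|{perm T}| <= #|[pred F : sgraph T | regular 2 F]| * #|T| ^ 2)%N.
Proof.
pose f (t : {perm T}) := (relabel t cycle_graph, (t o, t (s o))).
have cE x y : adj cycle_graph x y = (y == s x) || (x == s y).
  exact: (orientsP _ _ orients_cycle_graph).
have step t t' x : relabel t cycle_graph = relabel t' cycle_graph ->
    t x = t' x -> t (s x) = t' (s x) -> t (s (s x)) = t' (s (s x)).
  move=> E ex esx; set w := t'^-1%g (t (s (s x))).
  have tw : t (s (s x)) = t' w by rewrite permKV.
  have : adj (relabel t cycle_graph) (t (s x)) (t (s (s x))).
    by rewrite adj_relabel cE eqxx.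
  rewrite E esx tw adj_relabel cE => /orP[/eqP->//|].
  rewrite (inj_eq perm_inj) => /eqP xw.
  by have := s2 x; rewrite -(inj_eq (@perm_inj _ t)) tw ex xw eqxx.
have finj : injective f.
  move=> t t' ftt; have E : relabel t cycle_graph = relabel t' cycle_graph := congr1 fst ftt.
  case: ftt => _ eo eso; apply/permP => x; have [i ->] := trans x.
  suff [] : t (iter i s o) = t' (iter i s o) /\ t (s (iter i s o)) = t' (s (iter i s o)) by [].
  elim: i => [|i [IH1 IH2]] //=; split => //.
  exact: step IH1 IH2.
rewrite -(card_codom finj).
apply: (@leq_trans #|predX [pred F : sgraph T | regular 2 F] (predT : pred (T * T))|).
  apply/subset_leq_card/fintype.subsetP => _ /codomP[t ->].
  by rewrite !inE /= regular_relabel regular_cycle_graph.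
by rewrite cardX card_prod.
Qed.

End HamiltonCycles.

(** * Absorbing the short cycles into the long one *)

Lemma perm_absorb (V : eqType) (A B C : seq V) (p q x : V) :
  perm_eq ((rev A ++ [:: p]) ++ x :: C ++ B ++ [:: q])
          (A ++ p :: q :: B ++ x :: C).
Proof. by apply/seq.permP => P; rewrite !(count_cat, count_rev) /= !count_cat /=; lia. Qed.

Section Absorption.
Variables (V : finType) (g H : rel V) (d : nat).
Hypotheses (Hsym : symmetric H) (gH : subrel g H).

(** The path [A, p, q, B] is cut between [p] and [q]; both halves are rerouted,
    with their outer ends fixed, so that their inner ends become adjacent to the
    two ends of the opened cycle [x :: C]. *)
Lemma absorb_cycle (A B C : seq V) (p q x : V) :
  ~~ odd (size A) -> ~~ odd (size B) ->
  path H p (rev A) -> path H q B -> path H x C ->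
  linked g d [set p]%SET x (pairs (rev A)) ->
  linked g d [set q]%SET (last x C) (pairs B) ->
  exists P, [/\ path H (head p A) P, last (head p A) P = last q B
     & perm_eq (head p A :: P) (A ++ p :: q :: B ++ x :: C)].
Proof.
move=> oA oB pA pB pC lA lB.
have single v r : r \in [set v]%SET ->
    exists Q, [/\ path H v Q, perm_eq (v :: Q) [:: v] & last v Q = r].
  by rewrite !inE => /eqP->; exists [::].
have oA' : ~~ odd (size (rev A)) by rewrite size_rev.
have [Q [hQ pQ gQ]] := reroute Hsym gH oA' pA (single p) lA.
have [Q' [hQ' pQ' gQ']] := reroute Hsym gH oB pB (single q) lB.
have hA : last p (rev A) = head p A by case: (A) => //= a A'; rewrite rev_cons last_rcons.
rewrite hA in hQ pQ gQ; set a := head p A in hQ pQ gQ *.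
set b := last q B in hQ' pQ' gQ' *.
have hrev : rev (b :: Q') = last b Q' :: rev (belast b Q') by rewrite lastI rev_rcons.
exists (Q ++ x :: C ++ rev (b :: Q')); split.
- rewrite cat_path hQ /= Hsym (gH gQ) cat_path pC hrev /= (gH gQ') /=.
  by rewrite -(eq_path (e := fun u v => H v u)) ?rev_path // => u v; rewrite Hsym.
- by rewrite last_cat /= last_cat rev_cons last_rcons.
- rewrite -cat_cons.
  have rw (X1 X2 Y1 Y2 : seq V) : perm_eq X1 Y1 -> perm_eq X2 Y2 ->
      perm_eq (X1 ++ x :: C ++ X2) (Y1 ++ x :: C ++ Y2).
    by move=> e1 e2; rewrite perm_cat //= perm_cons perm_cat.
  have pr : perm_eq (rev (b :: Q')) (B ++ [:: q]) by rewrite perm_rev.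
  apply: perm_trans (rw _ _ _ _ pQ pr) _.
  exact: perm_absorb.
Qed.

(** The ends of [arc] are kept, so absorptions in disjoint arcs of a path do not
    interfere. *)
Definition absorbs (arc C : seq V) : Prop :=
  exists a arc' P, [/\ arc = a :: arc', path H a P, last a P = last a arc'
     & perm_eq (a :: P) (arc ++ C)].

(** Consecutive arcs of length [l] each absorb one of the given sequences. *)
Lemma splice l (Cs : seq (seq V)) (c : seq V) z : (0 < l)%N ->
  (size Cs * l <= size c)%N -> path H z c ->
  (forall j, (j < size Cs)%N -> absorbs (take l (drop (j * l) c)) (nth [::] Cs j)) ->
  exists c', [/\ path H z c', last z c' = last z c & perm_eq c' (c ++ flatten Cs)].
Proof.
move=> l0; elim: Cs c z => [|C Cs IH] c z szc pc abs.
  by exists c; split => //; rewrite cats0.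
have /= [a [arc [P [E hP lP pP]]]] := abs 0 isT; rewrite mul0n drop0 in E pP.
move: pc; rewrite -{1}(cat_take_drop l c) E cat_path /= => /andP[/andP[za parc] p2].
have szc' : (size Cs * l <= size (drop l c))%N.
  by rewrite size_drop; move: szc => /=; rewrite mulSn; lia.
have abs' j : (j < size Cs)%N ->
    absorbs (take l (drop (j * l) (drop l c))) (nth [::] Cs j).
  by have := abs j.+1; rewrite drop_drop mulSn addnC; apply.
have [c2 [pc2 lc2 pmc2]] := IH (drop l c) (last a arc) szc' p2 abs'.
exists (a :: P ++ c2); split.
- by rewrite /= za cat_path hP lP pc2.
- by rewrite /= last_cat lP lc2 -[in RHS](cat_take_drop l c) E last_cat.
- rewrite -cat_cons; apply: perm_trans (perm_cat pP pmc2) _.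
  by rewrite /= -catA -{3}(cat_take_drop l c) -catA perm_cat2l perm_catCA.
Qed.

End Absorption.

(** * Orbits as closed walks, and the probability of failing to absorb one *)

Section OrbitWalk.
Variables (V : finType) (s : {perm V}).
Implicit Types (x y : V).

Definition orbit_walk x := traject s x #|porbit s x|.

Lemma mem_orbit_walk x : orbit_walk x =i porbit s x.
Proof. by move=> y; rewrite porbit_traject. Qed.

Lemma orbit_walkE x : orbit_walk x = x :: traject s (s x) #|porbit s x|.-1.
Proof. by rewrite /orbit_walk; have := card_porbit_neq0 s x; case: #|_|. Qed.

Lemma cycle_orbit_walk x : path.cycle (frel s) (orbit_walk x).
Proof.
rewrite orbit_walkE /= rcons_path fpath_traject last_traject /= -iterS prednK.
  by rewrite iter_porbit.
by rewrite lt0n card_porbit_neq0.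
Qed.

Lemma sum_porbits : (\sum_(C in porbits s) #|C| = #|V|)%N.
Proof.
rewrite -sum1_card (partition_big (porbit s) [in porbits s]) /=; last first.
  by move=> x _; apply: imset_f.
apply: eq_bigr => _ /imsetP[y _ ->]; rewrite sum1dep_card -sum1_card.
by rewrite sum1dep_card; apply: eq_card => x; rewrite !inE eq_porbit_mem.
Qed.

Lemma large_porbit : (0 < #|V|)%N ->
  exists x, (#|V| <= #|porbits s| * #|porbit s x|)%N.
Proof.
move=> /card_gt0P[x0 _]; have [x _ xmax] := @arg_maxnP _ x0 predT (fun x => #|porbit s x|) isT.
exists x; rewrite -sum_porbits -sum_nat_const.
by apply: leq_sum => _ /imsetP[y _ ->]; apply: xmax.
Qed.

(** The default value [o] is never reached on orbits. *)
Definition representative o (C : {set V}) := odflt o [pick x in C].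

Lemma porbit_representative o C : C \in porbits s ->
  porbit s (representative o C) = C.
Proof.
move=> /imsetP[y _ ->]; rewrite /representative; case: pickP => [x|/(_ y)].
  by rewrite -eq_porbit_mem => /eqP.
by rewrite porbit_id.
Qed.

Definition other_walks o :=
  [seq orbit_walk (representative o C) | C <- enum (porbits s :\ porbit s o)%SET].

Lemma all_walks o : perm_eq (orbit_walk o ++ flatten (other_walks o)) (enum V).
Proof.
have cover : enum V =i orbit_walk o ++ flatten (other_walks o).
  move=> x; rewrite mem_enum mem_cat mem_orbit_walk -eq_porbit_mem.
  have [//|xo] := eqVneq (porbit s x) (porbit s o); apply/esym/flattenP.
  have xP : porbit s x \in porbits s by apply: imset_f.
  exists (orbit_walk (representative o (porbit s x))).
    by apply/mapP; exists (porbit s x); rewrite // mem_enum !inE xo.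
  by rewrite mem_orbit_walk porbit_representative // porbit_id.
rewrite perm_sym; apply: uniq_perm; rewrite ?enum_uniq //.
rewrite (uniq_size_uniq (enum_uniq V) cover) -cardE -sum_porbits.
rewrite size_cat size_traject size_flatten /shape -map_comp sumnE big_map big_enum /=.
have oP : porbit s o \in porbits s by apply: imset_f.
rewrite (bigD1 _ oP) /=; apply/eqP; congr (_ + _)%N.
apply: eq_big => C; first by rewrite !inE andbC.
by rewrite inE => /andP[_ CP]; rewrite size_traject porbit_representative.
Qed.

Lemma size_other_walks o : (size (other_walks o)).+1 = #|porbits s|.
Proof.
rewrite size_map -cardE [RHS](cardsD1 (porbit s o)) imset_f //.
Qed.

End OrbitWalk.

Section Anchored.
Variables (V : finType) (g : rel V) (d : nat) (o : V).
Implicit Types (t : {perm V}) (arc C : seq V) (m : nat).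

(** The two explorations that let [arc] absorb [C]: one runs backwards from the
    middle of [arc] and aims at the head of [C], the other runs forwards and aims
    at the last vertex of [C]. *)
Definition anchored m arc C t : bool :=
  linked g d [set t (nth o arc (2 * m))]%SET (t (head o C))
    (pairs (map t (rev (take (2 * m) arc)))) &&
  linked g d [set t (nth o arc (2 * m + 1))]%SET (t (last o C))
    (pairs (map t (drop (2 * m + 2) arc))).

Lemma arc_split m arc : size arc = (4 * m + 2)%N ->
  arc = take (2 * m) arc ++ nth o arc (2 * m) :: nth o arc (2 * m + 1)
          :: drop (2 * m + 2) arc.
Proof.
move=> sz; rewrite -[in LHS](cat_take_drop (2 * m) arc); congr (_ ++ _).
by rewrite (drop_nth o) ?(drop_nth o (n := (2 * m).+1)) ?addn1 ?addn2 //; lia.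
Qed.

Lemma anchored_absorbs (H : rel V) m arc C t :
  symmetric H -> subrel g H ->
  size arc = (4 * m + 2)%N -> C != [::] ->
  sorted H (map t arc) -> sorted H (map t C) ->
  anchored m arc C t -> absorbs H (map t arc) (map t C).
Proof.
move=> Hsym gH sz; case: C => // x C _ sa sC /andP[].
have E := arc_split sz; rewrite E map_cat /= in sa.
set A := take _ _ in E sa *; set p := nth _ _ _ in E sa *.
set B := drop _ _ in E sa *; set q := nth _ _ _ in E sa * => lA lB.
have szA : size A = (2 * m)%N by rewrite size_takel // sz; lia.
have szB : size B = (2 * m)%N by rewrite size_drop sz; lia.
have pB : path H (t q) (map t B) by case/cat_sorted2: sa => _ /= /andP[].
have pA : path H (t p) (rev (map t A)).
  rewrite -cat_rcons in sa; have [sA _] := cat_sorted2 sa.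
  have := rev_sorted H (rcons (map t A) (t p)); rewrite rev_rcons /= => ->.
  by rewrite (eq_sorted (e' := H)) // => u v; rewrite Hsym.
have [] := @absorb_cycle V g H d Hsym gH (map t A) (map t B) (map t C) (t p) (t q) (t x).
- by rewrite size_map szA mul2n odd_double.
- by rewrite size_map szB mul2n odd_double.
- exact: pA.
- exact: pB.
- exact: sC.
- by rewrite -map_rev.
- by rewrite last_map.
move=> P [hP lP pP].
exists (head (t p) (map t A)), (behead (map t arc)), P; split => //.
- by rewrite [in RHS]E map_cat; case: (A) E => [|a A'] E' /=; rewrite ?E' ?map_cat.
- rewrite lP E map_cat; case: (A) => //= a A'.
  by rewrite last_cat.
- by apply: perm_trans pP _; rewrite [arc in X in perm_eq _ X]E map_cat -catA.
Qed.

Lemma anchored_fails (F : realFieldType) n kap m arc C :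
  #|V| = n -> symmetric g ->
  (forall v, d <= #|g v|)%N -> (forall v, #|g v| <= kap * d)%N ->
  (4 <= d)%N -> (0 < kap)%N -> (d <= n)%N -> (8 * (m + 3) <= n)%N ->
  size arc = (4 * m + 2)%N -> C != [::] -> uniq (arc ++ C) ->
  \sum_(t : {perm V}) (~~ anchored m arc C t)%:R <=
  #|{perm V}|%:R * (2 * (n%:R * decay F n d kap ^+ m
     + n%:R / 2 ^+ d * (1 + 30 * (kap * d)%:R / n%:R) ^+ (2 * m + 2))) :> F.
Proof.
move=> cardV gsym dmin dmax d4 kap0 dn mn sz C0 uac.
set A := take (2 * m) arc; set p := nth o arc (2 * m).
set B := drop (2 * m + 2) arc; set q := nth o arc (2 * m + 1).
have szA : size A = (2 * m)%N by rewrite size_takel // sz; lia.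
have szB : size B = (2 * m)%N by rewrite size_drop sz; lia.
have uA : uniq (p :: head o C :: rev A).
  rewrite (perm_uniq (s2 := A ++ [:: p; head o C])); last first.
    by rewrite perm_sym perm_catC /= !perm_cons perm_sym perm_rev.
  apply: subseq_uniq uac; rewrite (arc_split sz) -catA cat_subseq //.
  rewrite -[[:: p; _]]cat1s -[_ ++ C]cat1s cat_subseq // sub1seq.
  by case: (C) C0 => //= x C' _; rewrite inE mem_cat inE eqxx !orbT.
have uB : uniq (q :: last o C :: B).
  rewrite (perm_uniq (s2 := (q :: B) ++ [:: last o C])); last first.
    by rewrite perm_sym /= perm_cons perm_catC.
  apply: subseq_uniq uac; rewrite (arc_split sz) -catA.
  apply: subseq_trans (suffix_subseq A _).
  apply: subseq_trans (subseq_cons _ p); apply: (cat_subseq (subseq_refl (q :: B))).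
  by rewrite sub1seq; case: (C) C0 => //= x C' _; apply: mem_last.
have szA' : size (rev A) = (2 * m)%N by rewrite size_rev.
have H1 := linked_fails F cardV gsym dmin dmax d4 kap0 uA szA' mn dn.
have H2 := linked_fails F cardV gsym dmin dmax d4 kap0 uB szB mn dn.
rewrite -[2]/(1 + 1) mulrDl mul1r mulrDr; apply: le_trans (lerD H1 H2).
rewrite -big_split /=; apply: ler_sum => t _; rewrite /anchored negb_and.
by case: (linked _ _ _ _ _); case: (linked _ _ _ _ _); rewrite /= ?addr0 ?add0r ?ler01 ?lerDl.
Qed.

End Anchored.

(** * Random relabellings of a graph with few cycles *)

Lemma subseq_flatten (T : eqType) (ss : seq (seq T)) j : (j < size ss)%N ->
  subseq (nth [::] ss j) (flatten ss).
Proof.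
elim: ss j => // s ss IH [|j] /= jss; first exact: prefix_subseq.
exact: subseq_trans (IH _ jss) (suffix_subseq _ _).
Qed.

Section Relabelled.
Variables (V : finType) (G F : sgraph V) (d : nat) (s : {perm V}) (o : V).
Hypothesis sF : orients s F.
Implicit Types (t : {perm V}).

Let H t : rel V := adj (gunion G (relabel t F)).

Lemma union_adj t x y : H t x y = adj G x y || adj (relabel t F) x y.
Proof. by rewrite /H /adj /= inE. Qed.

Lemma walk_adj t x y : frel s x y -> H t (t x) (t y).
Proof.
move=> /eqP sxy; rewrite union_adj adj_relabel (orientsP _ _ sF) sxy eqxx.
by rewrite orbT.
Qed.

(** Disjoint arcs of the orbit of [o], one for each of the other orbits. *)
Definition arc m j := take (4 * m + 2) (drop (j * (4 * m + 2)) (orbit_walk s o)).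

(** If every arc absorbs its orbit, splicing yields a closed walk through all
    vertices; it is a cycle because it lists each vertex once. *)
Lemma anchored_hamiltonian m t : (2 < #|V|)%N ->
  (size (other_walks s o) * (4 * m + 2) <= #|porbit s o|)%N ->
  (forall j, (j < size (other_walks s o))%N ->
     anchored (adj G) d o m (arc m j) (nth [::] (other_walks s o) j) t) ->
  hamiltonian (gunion G (relabel t F)).
Proof.
move=> V3 szW anch; set Cs := other_walks s o in szW anch *.
have Hsym : symmetric (H t) by apply: adjC.
have gH : subrel (adj G) (H t) by move=> x y xy; rewrite union_adj xy.
have walkH l : sorted (frel s) l -> sorted (H t) (map t l).
  by apply: homo_sorted => x y; apply: walk_adj.
have walk_sorted x : sorted (frel s) (orbit_walk s x).
  by rewrite orbit_walkE /= fpath_traject.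
have Cs_walk j : (j < size Cs)%N -> exists x, nth [::] Cs j = orbit_walk s x.
  move=> jC; have /mapP[C _ ->] := mem_nth [::] jC.
  by exists (representative o C).
have l0 : (0 < 4 * m + 2)%N by lia.
pose c := map t (orbit_walk s o); pose Ds := map (map t) Cs.
have szD : (size Ds * (4 * m + 2) <= size c)%N by rewrite /Ds /c 2!size_map size_traject.
have cE : c = t o :: map t (traject s (s o) #|porbit s o|.-1).
  by rewrite /c orbit_walkE.
have cyc : path.cycle (H t) c.
  have := cycle_orbit_walk s o; rewrite /c orbit_walkE /= -map_rcons.
  by apply: homo_path => x y; apply: walk_adj.
rewrite (cycle_path o) in cyc.
have [|c' [pc' lc' pmc']] := splice l0 szD cyc.
  move=> j; rewrite size_map => jC; rewrite (nth_map [::]) // -map_drop -map_take.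
  have [x Cx] := Cs_walk _ jC.
  apply: (@anchored_absorbs _ (adj G) d o _ m) => //; last exact: anch.
  - rewrite size_takel // size_drop size_traject.
    have : (j.+1 * (4 * m + 2) <= size Cs * (4 * m + 2))%N by rewrite leq_mul2r jC orbT.
    by rewrite mulSn; lia.
  - by rewrite Cx orbit_walkE.
  - by apply/walkH/take_sorted/drop_sorted.
  - by rewrite Cx; apply: walkH.
have pmV : perm_eq c' (map t (enum V)).
  apply: perm_trans pmc' _; rewrite /c /Ds -map_flatten -map_cat.
  by apply: perm_map; apply: all_walks.
have mem_c' x : x \in c'.
  by rewrite (perm_mem pmV) -(permKV t x) map_f // mem_enum.
have uc' : uniq c'.
  by rewrite (perm_uniq pmV) map_inj_uniq ?enum_uniq //; apply: perm_inj.
exists c'; split=> //; first by rewrite (perm_size pmV) size_map -cardE.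
apply/andP; split=> //; rewrite (cycle_path o).
suff -> : last o c' = last o c by [].
have [y c'E] : exists y, last o c' = last y c' by exists o.
move: lc'; case: (c') (mem_c' o) => // a c'' _ /=.
by rewrite cE /=.
Qed.

(** Union bound over the orbits to be absorbed. *)
Lemma hamiltonian_fails (R : realType) n k kap m :
  #|V| = n -> (2 < n)%N -> regular 2 F ->
  (forall v, d <= #|adj G v|)%N -> (forall v, #|adj G v| <= kap * d)%N ->
  (4 <= d)%N -> (0 < kap)%N -> (d <= n)%N -> (8 * (m + 3) <= n)%N ->
  (size (other_walks s o) <= k)%N ->
  (size (other_walks s o) * (4 * m + 2) <= #|porbit s o|)%N ->
  #|[set t : {perm V} | ~~ `[< hamiltonian (gunion G (relabel t F)) >]]%SET|%:R <=
  #|{perm V}|%:R * (k%:R * (2 * (n%:R * decay R n d kap ^+ m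
     + n%:R / 2 ^+ d * (1 + 30 * (kap * d)%:R / n%:R) ^+ (2 * m + 2)))) :> R.
Proof.
move=> cardV n3 reg dmin dmax d4 kap0 dn mn szk szW.
set eta := 2 * _; set Cs := other_walks s o in szk szW *.
have eta0 : 0 <= eta.
  have D0 : 0 <= decay R n d kap by apply: decay_ge0 => //; lia.
  have E0 : 0 <= 1 + 30 * (kap * d)%:R / n%:R :> R by rewrite addr_ge0 // divr_ge0 // mulr_ge0.
  have P0 : 0 <= n%:R / 2 ^+ d :> R by apply: divr_ge0 => //; apply: exprn_ge0.
  apply: mulr_ge0 => //; apply: addr_ge0; apply: mulr_ge0 => //; exact: exprn_ge0.
apply: (@le_trans _ _ (\sum_(j < size Cs) \sum_(t : {perm V})
    (~~ anchored (adj G) d o m (arc m j) (nth [::] Cs j) t)%:R)).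
  rewrite exchange_big /= -sum1dep_card natr_sum big_mkcond /=.
  apply: ler_sum => t _; case: ifP => [/asboolPn nham|_]; last by rewrite sumr_ge0.
  have [all_anch|] := boolP [forall j : 'I_(size Cs),
      anchored (adj G) d o m (arc m j) (nth [::] Cs j) t].
    case: nham; apply: (@anchored_hamiltonian m); rewrite ?cardV //.
    by move=> j jC; apply: (forallP all_anch (Ordinal jC)).
  rewrite negb_forall => /existsP[j nj].
  by rewrite (bigD1 j) //= nj ler_wpDr ?sumr_ge0.
apply: (@le_trans _ _ (\sum_(j < size Cs) #|{perm V}|%:R * eta)); last first.
  rewrite sumr_const card_ord -[_ *+ size Cs]mulr_natl mulrCA ler_wpM2l //.
  by rewrite ler_wpM2r // ler_nat.
apply: ler_sum => j _; have jC := ltn_ord j.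
have /mapP[C _ CE] := mem_nth [::] jC.
apply: anchored_fails => //.
- exact: adjC.
- rewrite size_takel // size_drop size_traject.
  have : (j.+1 * (4 * m + 2) <= size Cs * (4 * m + 2))%N by rewrite leq_mul2r jC orbT.
  by rewrite mulSn; lia.
- by rewrite CE orbit_walkE.
- have uall : uniq (orbit_walk s o ++ flatten Cs).
    by rewrite (perm_uniq (all_walks s o)) enum_uniq.
  apply: subseq_uniq uall; apply: cat_subseq.
    by rewrite (subseq_trans (take_subseq _ _)) // drop_subseq.
  exact: subseq_flatten.
Qed.

End Relabelled.

(** * Choice of parameters and numerical estimates *)

(** Twice [m] is the length of the walk used by one exploration. The third
    condition makes the potential decay below [1 / n ^ 3]; the second lets an
    orbit of length at least [n / (3 * lam)] contain [3 * lam] arcs; the last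
    keeps the number of exposed labels small. Together they require [d] to be of
    the order of [lam ^ 3], one factor [lam] coming from the number of orbits,
    one from the length of the longest and one from the number of steps. *)
Lemma parameters n lam kap d : (0 < kap)%N -> (0 < lam)%N -> (d <= n)%N ->
  (20 * 1000 * (kap ^ 2 * lam ^ 3) <= d)%N ->
  exists m, [/\ (8 * (m + 3) <= n)%N, (3 * lam * (3 * lam * (4 * m + 2)) <= n)%N,
    (96 * (kap * n * lam) <= m * d)%N & (m.+1 * d <= 98 * (kap * n * lam))%N].
Proof.
move=> k0 l0 dn big.
have b1 : (kap * lam <= kap ^ 2 * lam ^ 3)%N.
  by rewrite -[(kap * lam)%N]/(kap ^ 1 * lam ^ 1)%N leq_mul // leq_pexp2l.
have b2 : (lam ^ 2 <= kap ^ 2 * lam ^ 3)%N.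
  by rewrite -[leqLHS]mul1n leq_mul ?expn_gt0 ?k0 // leq_pexp2l.
have b3 : (kap * lam ^ 3 <= kap ^ 2 * lam ^ 3)%N.
  by rewrite leq_mul2r -[leqLHS]expn1 leq_pexp2l ?orbT.
have b4 : (0 < kap ^ 2 * lam ^ 3)%N by rewrite muln_gt0 !expn_gt0 k0 l0.
move: (kap ^ 2 * lam ^ 3)%N big b1 b2 b3 b4 => K big b1 b2 b3 b4.
have d0 : (0 < d)%N by lia.
have d1 : (1536 * (kap * lam) <= d)%N by move: (kap * lam)%N b1 => y b1; lia.
have d2 : (48 * 144 * (kap * lam ^ 3) <= d)%N by move: (kap * lam ^ 3)%N b3 => y b3; lia.
have d3 : (108 * lam ^ 2 <= n)%N by move: (lam ^ 2)%N b2 => y b2; lia.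
have d4 : (64 <= n)%N by lia.
set X := (kap * n * lam)%N.
have nX : (n <= X)%N by rewrite /X -mulnA mulnCA leq_pmulr // muln_gt0 k0.
set q := ((96 * X) %/ d)%N.
have q1 : (q * d <= 96 * X)%N by apply: leq_divM.
have q2 : (96 * X < q.+1 * d)%N by apply: ltn_ceil.
have c1 : (1536 * X <= n * d)%N.
  rewrite /X (_ : 1536 * (kap * n * lam) = n * (1536 * (kap * lam)))%N; last by clear; nia.
  by rewrite leq_mul2l d1 orbT.
have c2 : (64 * d <= n * d)%N by rewrite leq_mul2r d4 orbT.
have c3 : (48 * 144 * (lam ^ 2 * X) <= n * d)%N.
  rewrite /X (_ : 48 * 144 * (lam ^ 2 * (kap * n * lam)) = n * (48 * 144 * (kap * lam ^ 3)))%N; last first.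
    by rewrite (expnSr lam 2); move: (lam ^ 2)%N; clear => y; nia.
  by rewrite leq_mul2l d2 orbT.
have c4 : (108 * (lam ^ 2 * d) <= n * d)%N.
  by rewrite mulnA leq_mul2r d3 orbT.
exists q.+1; split.
- rewrite -(leq_pmul2r d0) (_ : _ * d = 8 * (q * d) + 32 * d)%N; last by clear; nia.
  by move: q1 c1 c2; clear; lia.
- rewrite -(leq_pmul2r d0).
  rewrite (_ : _ * d = 36 * (lam ^ 2 * (q * d)) + 54 * (lam ^ 2 * d))%N; last first.
    by rewrite -!mulnn; clear; nia.
  have : (lam ^ 2 * (q * d) <= lam ^ 2 * (96 * X))%N by rewrite leq_mul2l q1 orbT.
  by move: c3 c4; rewrite (mulnCA _ 96); clear; lia.
- exact: ltnW.
- by rewrite !mulSn; lia.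
Qed.

Section Estimates.
Variable R : realType.

Lemma expR_half_le2 : expR (1 / 2) <= 2 :> R.
Proof.
have h1 : 1 / 2 <= expR (- (1 / 2)) :> R by apply: le_trans (expR_ge1Dx _); lra.
have := expRxMexpNx_1 (1 / 2 : R); have := expR_gt0 (1 / 2 : R).
by move: (expR _) (expR _) h1 => x y; nra.
Qed.

Lemma expR1_le4 : expR 1 <= 4 :> R.
Proof.
have -> : 1 = 1 / 2 + 1 / 2 :> R by lra.
by rewrite expRD; have := expR_ge0 (1 / 2 : R); have := expR_half_le2; nra.
Qed.

Lemma decay_le n d kap lam m : (0 < n)%N -> (0 < kap)%N -> (0 < d <= n)%N ->
  (96 * (kap * n * lam) <= m * d)%N -> decay R n d kap ^+ m <= 8 ^- lam.
Proof.
move=> n0 k0 /andP[d0 dn] mX.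
have N0 : 0 < 32 * kap%:R * n%:R :> R by rewrite !mulr_gt0 ?ltr0n.
have e1 : decay R n d kap <= expR (- (d%:R / (32 * kap%:R * n%:R))).
  by apply: expR_ge1Dx.
apply: (@le_trans _ _ (expR (- (d%:R / (32 * kap%:R * n%:R))) ^+ m)).
  by apply: lerXn2r => //; rewrite nnegrE ?expR_ge0 ?decay_ge0.
rewrite -expRM_natl.
have two : 2 <= expR 1 :> R by apply: le_trans (expR_ge1Dx _); lra.
have -> : 8 ^- lam = (2 ^+ (3 * lam))^-1 :> R.
  by rewrite exprM (_ : 2 ^+ 3 = 8) //; ring.
rewrite mulrN expRN lef_pV2 ?posrE ?expR_gt0 ?exprn_gt0 //.
apply: (@le_trans _ _ (expR 1 ^+ (3 * lam))).
  by apply: lerXn2r => //; rewrite nnegrE ?expR_ge0.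
rewrite -expRM_natl mulr1 ler_expR mulrA ler_pdivlMr //.
by rewrite -!natrM ler_nat; apply: leq_trans mX; clear; lia.
Qed.

Lemma spread_le n d kap lam m : (0 < n)%N ->
  (m.+1 * d <= 98 * (kap * n * lam))%N -> (20 * 1000 * (kap ^ 2 * lam) <= d)%N ->
  (0 < kap)%N ->
  (1 + 30 * (kap * d)%:R / n%:R) ^+ (2 * m + 2) / 2 ^+ d <= 8 ^- lam :> R.
Proof.
move=> n0 mX big k0.
have nR : 0 < n%:R :> R by rewrite ltr0n.
have e1 : 1 + 30 * (kap * d)%:R / n%:R <= expR (30 * (kap * d)%:R / n%:R) :> R.
  exact: expR_ge1Dx.
have four := expR1_le4.
have e2 : (1 + 30 * (kap * d)%:R / n%:R) ^+ (2 * m + 2) <= 4 ^+ (60 * 98 * (kap ^ 2 * lam)) :> R.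
  apply: (@le_trans _ _ (expR (30 * (kap * d)%:R / n%:R) ^+ (2 * m + 2))).
    by apply: lerXn2r; rewrite // nnegrE ?expR_ge0 // addr_ge0 // divr_ge0 // mulr_ge0.
  apply: (@le_trans _ _ (expR 1 ^+ (60 * 98 * (kap ^ 2 * lam)))); last first.
    by apply: lerXn2r; rewrite // nnegrE ?expR_ge0.
  rewrite -!expRM_natl mulr1 ler_expR mulrA ler_pdivrMr // -!natrM ler_nat.
  have : (kap * (m.+1 * d) <= kap * (98 * (kap * n * lam)))%N by rewrite leq_mul2l mX orbT.
  by rewrite -mulnn; clear; nia.
rewrite ler_pdivrMr ?exprn_gt0 //; apply: le_trans e2 _.
rewrite mulrC ler_pdivlMr ?exprn_gt0 //.
have -> : 4 = 2 ^+ 2 :> R by ring.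
have -> : 8 = 2 ^+ 3 :> R by ring.
rewrite -!exprM -exprD.
rewrite ler_eXn2l ?ltr1n //.
have : (0 < kap ^ 2)%N by rewrite expn_gt0 k0.
move: big; move: (kap ^ 2)%N => y; clear; nia.
Qed.

End Estimates.

(** * The proportion of bad 2-regular graphs *)

Lemma bigminn_le (I : eqType) (r : seq I) (f : I -> nat) a x : x \in r ->
  (\big[minn/a]_(y <- r) f y <= f x)%N.
Proof.
elim: r => // y r IH; rewrite inE big_cons => /orP[/eqP->|/IH le].
  exact: geq_minl.
exact: leq_trans (geq_minr _ _) le.
Qed.

Lemma bigminn_le_idx (I : Type) (r : seq I) (f : I -> nat) a :
  (\big[minn/a]_(y <- r) f y <= a)%N.
Proof.
by elim: r => [|y r IH]; rewrite ?big_nil // big_cons (leq_trans (geq_minr _ _)).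
Qed.

Lemma min_deg_le (T : finType) (G : sgraph T) x : (min_deg G <= #|adj G x|)%N.
Proof.
apply: leq_trans (bigminn_le _ _ (mem_index_enum x)) _.
by rewrite /deg; apply/eq_leq/eq_card.
Qed.

Lemma max_deg_ge (T : finType) (G : sgraph T) x : (#|adj G x| <= max_deg G)%N.
Proof.
by apply: leq_trans (leq_bigmax x); rewrite /deg; apply/eq_leq/eq_card.
Qed.

(** The lower bound of [card_regular2_ge] for the cycle [i |-> i + 1] modulo [n]. *)
Lemma many_regular2 n : (2 < n)%N ->
  (#|{perm 'I_n}| <= #|[pred F : sgraph 'I_n | regular 2 F]| * n ^ 2)%N.
Proof.
move=> n3.
pose rot : {perm 'I_n} := perm (@ordS_inj n).
have rotE i x : nat_of_ord (iter i rot x) = ((x + i) %% n)%N.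
  elim: i => [|i IH]; first by rewrite addn0 modn_small.
  by rewrite iterS permE /= IH addnS -addn1 modnDml addn1.
have rot_neq i x : (0 < i < n)%N -> iter i rot x != x.
  move=> /andP[i0 ni]; apply/eqP => /(congr1 (@nat_of_ord n)); rewrite rotE.
  have xn := ltn_ord x; case: (ltnP (x + i)%N n) => h; first by rewrite modn_small //; lia.
  by rewrite -(subnK h) modnDr modn_small; lia.
have s1 x : rot x != x by apply: (rot_neq 1); lia.
have s2 x : rot (rot x) != x by apply: (rot_neq 2); lia.
have trans (x : 'I_n) : exists i, x = iter i rot (Ordinal (ltnW (ltnW n3))).
  by exists x; apply: val_inj; rewrite /= rotE add0n modn_small.
by have := card_regular2_ge s1 s2 trans; rewrite card_ord.
Qed.

Lemma cubic_bound (F : realFieldType) (N K c : F) :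
  N * (N * (N * c)) = 1 -> K * (N * N * c) <= 3 * N * (N * N * c) ->
  K * (2 * (N * (2 * c))) * N <= 12.
Proof. lra. Qed.

Lemma thirteen_bound (F : realFieldType) (P N M x : F) :
  0 <= P -> M * x <= N -> 12 * P * N + P * x * M <= P * (13 * N).
Proof. by move=> P0 /(ler_wpM2l P0); lra. Qed.

Section Ratio.
Variables (R : realType) (n lam kap : nat) (G : sgraph 'I_n).
Hypotheses (lam0 : (0 < lam)%N) (kap0 : (0 < kap)%N) (nlam : (n < 2 ^ lam)%N).
Hypothesis dmax : (max_deg G <= kap * min_deg G)%N.
Hypothesis dbig : (20 * 1000 * (kap ^ 2 * lam ^ 3) <= min_deg G)%N.

(** Graphs with at least [3 * lam] cycles form a proportion at most [1 / n]. For
    the others, at most [6 * lam] explorations fail with probability at most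
    [2 / n ^ 2] each, which gives [12 / n] since [lam <= n]. *)
Lemma bad_ratio :
  #|[pred F : sgraph 'I_n | regular 2 F & ~~ `[< hamiltonian (gunion G F) >]]|%:R
    * n%:R <= 13 * #|[pred F : sgraph 'I_n | regular 2 F]|%:R :> R.
Proof.
pose d := min_deg G; have dbigd : (20 * 1000 * (kap ^ 2 * lam ^ 3) <= d)%N := dbig.
have dn : (d <= n)%N by rewrite -[leqRHS]card_ord; apply: bigminn_le_idx.
have [m [m1 m2 m3 m4]] := parameters kap0 lam0 dn dbigd.
have kl : (kap ^ 2 * lam <= kap ^ 2 * lam ^ 3)%N.
  by rewrite leq_mul2l -[X in (X <= _)%N]expn1 leq_pexp2l ?orbT.
have kl0 : (0 < kap ^ 2 * lam)%N by rewrite muln_gt0 expn_gt0 kap0.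
have dbig' : (20 * 1000 * (kap ^ 2 * lam) <= d)%N.
  by apply: leq_trans dbigd; rewrite leq_mul2l kl orbT.
have d4 : (4 <= d)%N by move: (kap ^ 2 * lam)%N kl0 dbig' => y; clear; lia.
have n0 : (0 < n)%N by apply: leq_trans dn; apply: leq_trans d4.
have n3 : (2 < n)%N by apply: leq_trans dn; apply: leq_trans d4.
have nR : 0 < n%:R :> R by rewrite ltr0n.
have gmin v : (d <= #|adj G v|)%N by apply: min_deg_le.
have gmax v : (#|adj G v| <= kap * d)%N by apply: leq_trans (max_deg_ge G v) dmax.
have lamn : (lam <= n)%N.
  apply: leq_trans dn; apply: leq_trans dbig'; rewrite mulnA.
  by rewrite leq_pmull // !muln_gt0 kap0.
have n8 : n%:R ^+ 3 <= 8 ^+ lam :> R.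
  rewrite -!natrX ler_nat (_ : 8 = 2 ^ 3)%N // -expnM mulnC expnM.
  by rewrite leq_exp2r // ltnW.
have n8V : 8 ^- lam <= n%:R ^- 3 :> R by rewrite lef_pV2 ?posrE ?exprn_gt0.
pose bad F := ~~ `[< hamiltonian (gunion G F) >].
pose k := (3 * lam)%N.
pose NN := #|[pred F : sgraph 'I_n | regular 2 F]|.
pose many := #|[pred F : sgraph 'I_n | regular 2 F & (k <= #|porbits (orientation F)|)%N]|.
have nfact : 0 < #|{perm 'I_n}|%:R :> R.
  by rewrite ltr0n; apply/card_gt0P; exists 1%g.
have many_le : many%:R * n%:R <= NN%:R :> R.
  have h := leq_trans (many_cycles 'I_n k) (many_regular2 n3).
  rewrite -(ler_pM2r (x := n%:R ^+ 2)) ?exprn_gt0 // -mulrA -exprS.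
  apply: (@le_trans _ _ (many%:R * 8 ^+ lam)); first by rewrite ler_wpM2l.
  have -> : 8 ^+ lam = (2 ^ (3 * lam))%:R :> R.
    by rewrite expnM natrX.
  by rewrite -natrX -!natrM ler_nat.
have few F : regular 2 F -> (#|porbits (orientation F)| < k)%N ->
    #|[set t : {perm 'I_n} | bad (relabel t F)]%SET|%:R * n%:R <=
      12 * #|{perm 'I_n}|%:R :> R.
  move=> reg cyc; have sF := orientationP reg.
  have [|o ho] := @large_porbit 'I_n (orientation F); first by rewrite card_ord.
  rewrite card_ord in ho; have szW := size_other_walks (orientation F) o.
  have szk : (size (other_walks (orientation F) o) <= k)%N by lia.
  have szo : (size (other_walks (orientation F) o) * (4 * m + 2)
      <= #|porbit (orientation F) o|)%N.
    apply: (@leq_trans (k * (4 * m + 2))); first by rewrite leq_mul2r szk orbT.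
    have k0 : (0 < k)%N by rewrite muln_gt0.
    rewrite -(leq_pmul2l k0); apply: leq_trans m2 (leq_trans ho _).
    by rewrite leq_mul2r (ltnW cyc) orbT.
  have := @hamiltonian_fails _ G F d _ o sF R n k kap m (card_ord n) n3 reg gmin gmax
    d4 kap0 dn m1 szk szo.
  set P := #|[set t | _]%SET|%:R => hP.
  apply: le_trans (ler_wpM2r (ltW nR) hP) _; rewrite -[leLHS]mulrA [leRHS]mulrC ler_wpM2l ?(ltW nfact) //.
  have e1 := @decay_le R n d kap lam m n0 kap0 _ m3.
  have {}e1 : decay R n d kap ^+ m <= n%:R ^- 3.
    by apply: le_trans n8V; apply: e1; rewrite dn andbT; apply: leq_trans d4.
  have e2 : (1 + 30 * (kap * d)%:R / n%:R) ^+ (2 * m + 2) / 2 ^+ d <= n%:R ^- 3 :> R.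
    by apply: le_trans n8V; apply: spread_le.
  have kR : k%:R <= 3 * n%:R :> R by rewrite -natrM ler_nat leq_mul2l lamn.
  have -> : n%:R / 2 ^+ d * (1 + 30 * (kap * d)%:R / n%:R) ^+ (2 * m + 2) =
      n%:R * ((1 + 30 * (kap * d)%:R / n%:R) ^+ (2 * m + 2) / 2 ^+ d) :> R.
    by rewrite mulrAC -mulrA.
  rewrite -mulrDr; set S := _ + _.
  have cn : n%:R * (n%:R * (n%:R * n%:R ^- 3)) = 1 :> R.
    by field; rewrite gt_eqF.
  have S2 : S <= 2 * n%:R ^- 3 by rewrite mulr_natl mulr2n lerD.
  have c0 : 0 <= n%:R ^- 3 :> R by rewrite invr_ge0 exprn_ge0 // ltW.
  apply: (@le_trans _ _ (k%:R * (2 * (n%:R * (2 * n%:R ^- 3))) * n%:R)).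
    by rewrite ler_wpM2r ?(ltW nR) // ler_wpM2l // ler_wpM2l // ler_wpM2l // ltW.
  have := ler_wpM2r (mulr_ge0 (mulr_ge0 (ltW nR) (ltW nR)) c0) kR.
  exact: cubic_bound.
have avg := @relabel_average _ (regular 2) bad (fun t F => regular_relabel 2 t F).
rewrite -(ler_pM2l nfact) [leLHS]mulrA -[X in X * _]natrM avg.
rewrite natr_sum mulr_suml.
apply: (@le_trans _ _ (\sum_(F : sgraph 'I_n | regular 2 F)
   (12 * #|{perm 'I_n}|%:R + #|{perm 'I_n}|%:R * n%:R *
      (k <= #|porbits (orientation F)|)%N%:R))).
  apply: ler_sum => F reg; case: leqP => cyc; last by rewrite mulr0 addr0; apply: few.
  rewrite mulr1 ler_wpDl ?mulr_ge0 // ler_wpM2r // ler_nat.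
  exact: max_card.
rewrite big_split /= sumr_const -/NN -mulr_sumr.
have -> : \sum_(F : sgraph 'I_n | regular 2 F) (k <= #|porbits (orientation F)|)%N%:R = many%:R :> R.
  rewrite /many -sum1_card natr_sum big_mkcondr /= [RHS]big_mkcond [LHS]big_mkcond /=.
  by apply: eq_bigr => F _; case: (regular 2 F) => //=; case: (leq _ _).
rewrite -[_ *+ NN]mulr_natr.
exact: (thirteen_bound (ltW nfact) many_le).
Qed.

End Ratio.

(** * Passage to the limit *)

Lemma trunc_log_le_ln (R : realType) n : (4 <= n)%N ->
  (trunc_log 2 n).+1%:R <= 3 * ln n%:R :> R.
Proof.
move=> n4; have n0 : 0 < n%:R :> R by rewrite ltr0n; lia.
have l1 : 1 <= ln n%:R :> R.
  rewrite -ler_expR lnK ?posrE //; apply: le_trans (expR1_le4 R) _.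
  by rewrite ler_nat.
have l2 : (trunc_log 2 n)%:R / 2 <= ln n%:R :> R.
  rewrite -ler_expR lnK ?posrE // -[X in expR (X / 2)]mulr1 -mulrA expRM_natl.
  apply: (@le_trans _ _ (2 ^+ trunc_log 2 n)).
    by apply: lerXn2r; rewrite ?nnegrE ?expR_ge0 // expR_half_le2.
  by rewrite -natrX ler_nat trunc_logP //; lia.
rewrite -natr1; lra.
Qed.

Local Open Scope classical_set_scope.
Local Open Scope ring_scope.

Theorem theorem1p3 (R : realType) (G : forall n : nat, sgraph 'I_n)
  (hmin : ((min_deg (G n))%:R / (ln n%:R) ^+ 3 : R) @[n --> \oo] --> +oo)
  (hmax : exists K : R, \forall n \near \oo,
     (max_deg (G n))%:R <= K * (min_deg (G n))%:R) :
  random_regular_pr R n 2 (fun F => hamiltonian (gunion (G n) F))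
    @[n --> \oo] --> (1 : R).
Proof.
have [K hK] := hmax; pose kap := (Num.truncn K).+1.
apply/cvgrPdist_le => e e0.
(* The factor 27 = 3 ^ 3 absorbs the bound of lam by 3 * ln n. *)
move/cvgryPge: hmin => /(_ (27 * (20 * 1000 * kap ^ 2))%:R) hmin.
near=> n.
have n4 : (4 <= n)%N by near: n; exact: nbhs_infty_ge.
have n0 : 0 < n%:R :> R by rewrite ltr0n; lia.
have maxd : (max_deg (G n) <= kap * min_deg (G n))%N.
  rewrite -(ler_nat R) natrM; apply: (@le_trans _ _ (K * (min_deg (G n))%:R)).
    by near: n.
  by rewrite ler_wpM2r // ltW // truncnS_gt.
set lam := (trunc_log 2 n).+1.
have lam_ln : lam%:R <= 3 * ln n%:R :> R by apply: trunc_log_le_ln.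
have ln0 : 0 < ln n%:R :> R by rewrite ln_gt0 // ltr1n; lia.
have mind : (20 * 1000 * (kap ^ 2 * lam ^ 3) <= min_deg (G n))%N.
  rewrite -(ler_nat R).
  have : (27 * (20 * 1000 * kap ^ 2))%:R <= (min_deg (G n))%:R / ln n%:R ^+ 3 :> R by near: n.
  rewrite ler_pdivlMr ?exprn_gt0 //; apply: le_trans.
  rewrite mulnA; move: (20 * 1000 * kap ^ 2)%N => L.
  rewrite (natrM _ L) (natrM _ 27) natrX (mulrC 27%:R) -mulrA ler_wpM2l //.
  have -> : 27 * ln n%:R ^+ 3 = (3 * ln n%:R) ^+ 3 :> R by ring.
  by apply: lerXn2r; rewrite ?nnegrE // ltW // mulr_gt0.
have bad := @bad_ratio R n lam kap (G n) isT isT (trunc_log_ltn n (isT : (1 < 2)%N)) maxd mind.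
have N0 : 0 < #|[pred F : sgraph 'I_n | regular 2 F]|%:R :> R.
  rewrite ltr0n; have := many_regular2 (ltnW n4); rewrite lt0n.
  have : (0 < #|{perm 'I_n}|)%N by apply/card_gt0P; exists 1%g.
  by move=> p0 /(leq_trans p0); case: #|_|.
rewrite /random_regular_pr /uniform_pr.
have -> : #|@regular 'I_n 2| = #|[pred F : sgraph 'I_n | regular 2 F]| by apply: eq_card.
pose ham F := `[< hamiltonian (gunion (G n) F) >].
have split : (#|[pred F : sgraph 'I_n | regular 2 F]| =
    #|[pred F | regular 2 F & ham F]| + #|[pred F | regular 2 F & ~~ ham F]|)%N.
  rewrite -(cardID ham); congr (_ + _)%N; apply: eq_card => F; rewrite !inE //.
  by rewrite andbC.
rewrite -/(ham _) in bad *.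
move: N0 bad; rewrite split natrD.
set a := #|_|%:R; set b := #|[pred F | _ & ~~ _]|%:R => N0 bad.
have -> : 1 - a / (a + b) = b / (a + b) by field; rewrite gt_eqF.
rewrite ger0_norm ?divr_ge0 // ?(ltW N0) // ler_pdivrMr //.
have ne : 13 / e <= n%:R by near: n; exact: nbhs_infty_ger.
rewrite -(ler_pM2r n0); apply: le_trans bad _.
rewrite mulrAC ler_wpM2r ?(ltW N0) // mulrC -ler_pdivrMr //.
Unshelve. all: by end_near.
Qed.
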